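(* Let $N\geq 5$ and $R>0$. Then: (a) For all $u\in C_{0}^{\infty}(\mathbb{R}^{N})$, $$\int_{\mathbb{R}^{N}}|\Delta u|^{2}\,dx\geq\frac{N^{2}}{4}\int_{\mathbb{R}^{N}}\frac{|\nabla u|^{2}}{|x|^{2}}\,dx.$$ (b) For all $u\in C_{0}^{\infty}(B_{R})$, $$\int_{B_{R}}|\Delta u|^{2}\,dx\geq\frac{N^{2}}{4}\int_{B_{R}}\frac{|\nabla u|^{2}}{|x|^{2}\left(1-\left(\frac{R}{|x|}\right)^{-N}\right)^{2}}\,dx.$$ (c) For all $u\in C_{0}^{\infty}(B_{R})$, $$\int_{B_{R}}|\Delta u|^{2}\,dx\geq\frac{N^{2}}{4}\int_{B_{R}}\frac{|\nabla u|^{2}}{|x|^{2}}\,dx+\frac{z_{0}^{2}}{R^{2}}\int_{B_{R}}|\nabla u|^{2}\,dx.$$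
   Context: $B_R$ is the open ball of radius $R$ centered at the origin in $\mathbb{R}^N$. $C_0^\infty(\Omega)$ is the space of smooth functions with compact support in $\Omega$. $z_0=2.4048\ldots$ is the first (positive) zero of the Bessel function $J_0$. *)

(* Defs.v *)
From HB Require Import structures.
From mathcomp Require Import all_boot all_order all_algebra.
From mathcomp Require Import all_classical all_reals all_analysis.

Set Implicit Arguments.
Unset Strict Implicit.
Unset Printing Implicit Defensive.
Import Order.TTheory GRing.Theory Num.Theory.
Import numFieldNormedType.Exports.

Local Open Scope classical_set_scope.
Local Open Scope ring_scope.

(* The sigma-algebra on R^n is the product one, generated by the coordinates
   as for the library's n.-tuple T; it is the Borel sigma-algebra. The display
   of the coordinates is the one that lebesgue_measure uses. *)
Definition measure_rV_display : measure_display -> measure_display.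
Proof. exact. Qed.

Section measurable_rV.
Context {R : realType} (n : nat).

Let coord (i : 'I_n) (x : 'rV[R]_n) : measurableTypeR R := x ord0 i.

Let rV_set0 : g_sigma_preimage coord set0.
Proof. exact: sigma_algebra0. Qed.

Let rV_setC A : g_sigma_preimage coord A -> g_sigma_preimage coord (~` A).
Proof. exact: sigma_algebraC. Qed.

Let rV_bigcup (F : (set 'rV[R]_n)^nat) :
  (forall i, g_sigma_preimage coord (F i)) ->
  g_sigma_preimage coord (\bigcup_i (F i)).
Proof. exact: sigma_algebra_bigcup. Qed.

HB.instance Definition _ := @isMeasurable.Build (measure_rV_display
  (R.-ocitv.-measurable).-sigma)
  ('rV[R]_n) (g_sigma_preimage coord) rV_set0 rV_setC rV_bigcup.

End measurable_rV.

Section measurable_rV_theory.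
Context {R : realType}.
Local Notation mR := (measurableTypeR R).

Lemma measurable_rV_coord n (i : 'I_n) :
  measurable_fun [set: 'rV[R]_n] (fun x : 'rV[R]_n => x ord0 i : mR).
Proof.
move=> _ Y mY; rewrite setTI; apply: sub_sigma_algebra => /=.
rewrite -bigcup_seq/=; exists i => /=; first by rewrite mem_index_enum.
by exists Y => //; rewrite setTI.
Qed.

Lemma measurable_fun_rVP d' (T' : measurableType d') n (f : T' -> 'rV[R]_n) :
  (forall i, measurable_fun [set: T'] (fun x => f x ord0 i : mR)) ->
  measurable_fun [set: T'] f.
Proof.
move=> mf _ A mA; rewrite setTI.
have : (preimage_set_system setT f (@measurable _ 'rV[R]_n)) (f @^-1` A).
  by exists A => //; rewrite setTI.
rewrite /measurable/= -g_sigma_preimage_comp.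
apply: smallest_sub; first exact: sigma_algebra_measurable.
rewrite -bigcup_seq/=; apply: bigcup_sub => i _ _ [B mB <-].
exact: mf.
Qed.

Definition cons_rV n (p : mR * 'rV[R]_n) : 'rV[R]_n.+1 :=
  \row_i oapp (fun j => p.2 ord0 j) p.1 (unlift ord0 i).

Definition behead_rV n (x : 'rV[R]_n.+1) : 'rV[R]_n :=
  \row_i x ord0 (lift ord0 i).

Lemma measurable_cons_rV n : measurable_fun [set: mR * 'rV[R]_n] (@cons_rV n).
Proof.
apply: measurable_fun_rVP => i.
rewrite (_ : (fun _ => _) = fun p : mR * 'rV[R]_n =>
  oapp (fun j => p.2 ord0 j) p.1 (unlift ord0 i)); last first.
  by apply/funext => p; rewrite mxE.
case: unliftP => [j|] _ /=; last exact: measurable_fst.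
exact: (measurableT_comp (measurable_rV_coord j) measurable_snd).
Qed.

Lemma measurable_behead_rV n :
  measurable_fun [set: 'rV[R]_n.+1] (@behead_rV n).
Proof.
apply: measurable_fun_rVP => i.
rewrite (_ : (fun _ => _) = fun x : 'rV[R]_n.+1 => x ord0 (lift ord0 i)).
  exact: measurable_rV_coord.
by apply/funext => x; rewrite mxE.
Qed.

Lemma cons_rVK n (p : mR * 'rV[R]_n) :
  (cons_rV p ord0 ord0, behead_rV (cons_rV p)) = p.
Proof.
case: p => a x; congr pair; first by rewrite mxE unlift_none.
by apply/rowP => i; rewrite !mxE liftK.
Qed.

End measurable_rV_theory.

Section lebesgue_rV.
Local Open Scope ereal_scope.
Context {R : realType}.

Section step.
Variables (n : nat) (m : {sigma_finite_measure set 'rV[R]_n -> \bar R}).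

Definition lebesgue_cons : set 'rV[R]_n.+1 -> \bar R :=
  pushforward (@lebesgue_measure R \x m) (@cons_rV R n).

Let m0 : lebesgue_cons set0 = 0.
Proof. by rewrite /lebesgue_cons /pushforward preimage_set0 measure0. Qed.

Let m_ge0 A : 0 <= lebesgue_cons A.
Proof.
rewrite /lebesgue_cons /pushforward; exact: measure_ge0.
Qed.

Let m_sigma_additive : semi_sigma_additive lebesgue_cons.
Proof.
move=> F mF tF mUF; rewrite /lebesgue_cons /pushforward preimage_bigcup.
apply: measure_semi_sigma_additive.
- by move=> k; rewrite -[X in measurable X]setTI; exact: measurable_cons_rV.
- apply/trivIsetP => /= i j _ _ ij; rewrite -preimage_setI.
  by move/trivIsetP : tF => /(_ _ _ _ _ ij) ->//; rewrite preimage_set0.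
- rewrite -preimage_bigcup -[X in measurable X]setTI.
  exact: measurable_cons_rV.
Qed.

HB.instance Definition _ := isMeasure.Build _ _ _ lebesgue_cons
  m0 m_ge0 m_sigma_additive.

Let m_sigma_finite : sigma_finite setT lebesgue_cons.
Proof.
have [F TF mF] : sigma_finite setT (@lebesgue_measure R \x m).
  have /sigma_finiteP[F [TF ndF Foo]] := sigma_finiteT (@lebesgue_measure R).
  have /sigma_finiteP[G [TG ndG Goo]] := sigma_finiteT m.
  exists (fun k => F k `*` G k).
    rewrite -setXTT TF TG predeqE => -[x y]; split.
      move=> [/= [i _ Fix] [k _ Gky]]; exists (maxn i k) => //; split.
      - by move: x Fix; exact/subsetPset/ndF/leq_maxl.
      - by move: y Gky; exact/subsetPset/ndG/leq_maxr.
    by move=> [k _ []/= ? ?]; split; exists k.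
  move=> k; have [? ?] := Foo k; have [? ?] := Goo k.
  split; first exact: measurableX.
  by rewrite product_measure1E// lte_mul_pinfty// ge0_fin_numE.
pose g (x : 'rV[R]_n.+1) : measurableTypeR R * 'rV[R]_n := (x ord0 ord0, behead_rV x).
have mg : measurable_fun setT g.
  apply: measurable_fun_pair; first exact: measurable_rV_coord.
  exact: measurable_behead_rV.
exists (fun k => g @^-1` F k); first by rewrite -preimage_bigcup -TF.
move=> k; have [mFk Foo] := mF k; split.
  by rewrite -[X in measurable X]setTI; exact: mg.
rewrite /lebesgue_cons /pushforward.
rewrite (_ : _ @^-1` _ = F k)//.
by apply/seteqP; split => p /=; rewrite /g cons_rVK.
Qed.

HB.instance Definition _ := Measure_isSigmaFinite.Build _ _ _ lebesgue_cons
  m_sigma_finite.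

End step.

Fixpoint lebesgue_rV (n : nat) :
    {sigma_finite_measure set 'rV[R]_n -> \bar R} :=
  match n with
  | 0 => @dirac _ 'rV[R]_0 0%R R
  | k.+1 => lebesgue_cons (lebesgue_rV k)
  end.

Lemma measurable_rV_box n (A : 'I_n -> set R) :
  (forall i, measurable (A i)) ->
  measurable [set x : 'rV[R]_n | forall i, A i (x ord0 i)].
Proof.
move=> mA; rewrite [X in measurable X](_ : _ = \bigcap_(i in [set: 'I_n])
    [set x : 'rV[R]_n | A i (x ord0 i)]).
  apply: fin_bigcap_measurable; first exact: finite_finset.
  move=> i _; rewrite -[X in measurable X]setTI.
  exact: (measurable_rV_coord i measurableT (mA i)).
by apply/seteqP; split => x /= h i; [move=> _|]; apply: h.
Qed.

Lemma lebesgue_rV_box n (A : 'I_n -> set R) :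
  (forall i, measurable (A i)) ->
  lebesgue_rV n [set x | forall i, A i (x ord0 i)] =
  \prod_(i < n) lebesgue_measure (A i).
Proof.
elim: n A => [|n IH] A mA.
  by rewrite big_ord0 /= diracE mem_set// => -[].
rewrite big_ord_recl /= /lebesgue_cons /pushforward.
rewrite (_ : _ @^-1` _ = A ord0 `*`
    [set x : 'rV[R]_n | forall i, A (lift ord0 i) (x ord0 i)]).
  rewrite product_measure1E;
    last exact: (measurable_rV_box (fun i => mA (lift ord0 i))).
    by congr (_ * _); exact: (IH (fun i => A (lift ord0 i))).
  exact: mA.
apply/seteqP; split => -[a x] /=.
  move=> h; split=> [|i].
    by have := h ord0; rewrite mxE unlift_none.
  by have := h (lift ord0 i); rewrite mxE liftK.
by move=> [a0 h] i; rewrite mxE; case: unliftP => [j|] ->.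
Qed.

End lebesgue_rV.

Section calculus.
Context {R : realType} {N : nat}.
Implicit Types (u : 'rV[R]_N -> R) (x : 'rV[R]_N) (i : 'I_N).

(* The canonical norm of 'rV[R]_N is the sup norm. *)
Definition enorm x : R := Num.sqrt (\sum_i x ord0 i ^+ 2).

Definition eball (r : R) : set 'rV[R]_N := [set x | enorm x < r].

Definition partial i u : 'rV[R]_N -> R := 'D_(delta_mx ord0 i) u.

Definition gradient u x : 'rV[R]_N := \row_i partial i u x.

Definition laplacian u x : R := \sum_i partial i (partial i u) x.

(* [foldr partial u s] is the iterated partial derivative of u along the
   indices listed in s. *)
Definition smooth u :=
  forall (s : seq 'I_N) x, differentiable (foldr partial u s) x.

Definition supp u : set 'rV[R]_N := closure [set x | u x != 0].

(* C_0^oo(Omega), each function being extended by 0 outside of Omega. *)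
Definition test_function (Omega : set 'rV[R]_N) u :=
  [/\ smooth u, compact (supp u) & supp u `<=` Omega].

End calculus.

Section bessel.
Context {R : realType}.

(* The k-th term of the power series of J_0 at x. *)
Definition bessel_J0_term (x : R) (k : nat) : R :=
  (-1) ^+ k / (k`!%:R) ^+ 2 * (x / 2) ^+ (2 * k).

Definition bessel_J0 (x : R) : R := limn (series (bessel_J0_term x)).

Definition first_positive_zero (f : R -> R) (z : R) :=
  [/\ 0 < z, f z = 0 & forall y, 0 < y < z -> f y != 0].

End bessel.

(* Main.v *)
Require Import Defs.
From HB Require Import structures.
From mathcomp Require Import all_boot all_order all_algebra.
From mathcomp Require Import all_classical all_reals all_analysis.
From mathcomp Require Import measurable_realfun ring lra.
Import Order.TTheory GRing.Theory Num.Theory.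
Import numFieldNormedType.Exports.
Local Open Scope classical_set_scope.
Local Open Scope ring_scope.
Set Implicit Arguments.
Unset Strict Implicit.
Unset Printing Implicit Defensive.

(** Write [E] for the Euler field [x . grad], [L_ij = x_i d_j - x_j d_i] for the
    rotation fields and [Lam] for half of the sum of the squares of the latter,
    the spherical Laplacian. In polar form, [|x|^2 Lap = E E + (N - 2) E + Lam] and
    [|x|^2 |grad u|^2 = (E u)^2 + 1/2 sum (L_ij u)^2]. All three inequalities
    follow from a single one, in which the radial weight [W] comes from a solution
    of a one-dimensional Riccati equation: the integral of [(Lap u)^2] is at least
    that of [W |grad u|^2] ([rellich_riccati]). No expansion into spherical
    harmonics is used.

    The integral of [|x|^-4 (E E u + (N - 2) E u + Lam u)^2] is expanded by
    integrating by parts along [E] ([J_euler]) and along the [L_ij] ([J_rot]),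
    which commute with [E] and with [Lam]. With [g = E u] and [v = L_ij u], the
    result is the integral against [|x|^-4] of
    - the radial part [(E g)^2 + 2 (N - 2) g^2] ([J_reg2_radial]);
    - for each pair [(i, j)], the angular part [(E v)^2 + (N - 4) v^2]
      ([J_reg2_angular], [J_laplacian_split]);
    - [(Lam u)^2], which is at least [(N - 1) / 2] times the sum of the [v^2]
      ([J_sphere_gap]), by Bochner's argument on the sphere; its pointwise part
      [sum_rot_rot] is a Cauchy-Schwarz inequality for the tangential Hessian.

    The substitution [f = |x|^2 w] turns the integral of
    [|x|^-4 ((E f)^2 + 2 (N - 2) f^2)] into a Dirichlet integral of [w] in dimension
    [N + 2], to which a Hardy inequality with a general radial weight applies:
    completing a square that involves the logarithmic derivative [Psi] of a positive
    radial solution shows that it is at least the integral of [|x|^-2 W f^2]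
    ([hardy_riccati]). It is applied to [g], and to each [v] once with half of the
    weight [W] and once with half of the weight [N^2 / (4 |x|^2)]. What remains is a
    multiple of [v^2] with coefficient [(N^2 / 4 - N - 1) / 2], which is positive for
    [5 <= N] ([rellich_regularized]).

    Since [E u] and the [L_ij u] vanish at the origin, all these integrals converge
    for [5 <= N]. To keep the integrations by parts elementary, [|x|^-4] is replaced
    by [(|x|^2 + e)^-2]; the errors are of order [e] ([J_defect_le]) and Fatou's
    lemma removes the regularization.

    The three weights come from the solutions [|x|^(- N / 2)] ([riccati_cst]),
    [(|x|^-N - r^-N)^(1 / 2)] ([riccati_ball]) and [|x|^(- N / 2) J_0 (z0 |x| / r)]
    ([riccati_bessel]); the last one is positive in the ball because [z0] is the
    first zero of [J_0]. *)

(** * Lebesgue measure on row vectors *)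

Section rV_measure.
Context {R : realType}.
Implicit Types (n : nat).

(** The measurable sets are generated by the coordinates, that is by boxes, and
    an open set is the union of the boxes with rational centres and inverse integer
    half-width that it contains. *)
Lemma open_measurable_rV n (A : set 'rV[R]_n) : open A -> measurable A.
Proof.
move=> oA.
pose e k : R := k.+1%:R^-1.
pose B (p : 'rV[rat]_n * nat) : set 'rV[R]_n :=
  [set x | forall i, `]ratr (p.1 ord0 i) - e p.2, ratr (p.1 ord0 i) + e p.2[%classic (x ord0 i)].
pose F p := if `[< B p `<=` A >] then B p else set0.
have -> : A = \bigcup_p F p.
  apply/seteqP; split => [x Ax|x [p _]]; last first.
    by rewrite /F; case: ifPn => // /asboolP; exact.
  have /nbhs_ballP[d /= d0 dA] : nbhs x A by exact: open_nbhs_nbhs.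
  have [k kd] : exists k, e k < d / 2.
    have := near_infty_natSinv_lt (PosNum (divr_gt0 d0 (ltr0n R 2))).
    by move=> [k _ /(_ k)] /(_ (leqnn k)) /= ?; exists k.
  have ek : 0 < e k by rewrite /e invr_gt0 ltr0n.
  have /choice[q qP] : forall i : 'I_n, exists q : rat, ratr q \in `]x ord0 i - e k, x ord0 i + e k[.
    by move=> i; apply: rat_in_itvoo; rewrite ltrBlDr -addrA ltrDl addr_gt0.
  exists (\row_i q i, k) => //.
  have Bx : B (\row_i q i, k) x.
    move=> i; rewrite /= mxE in_itv/=; have := qP i; rewrite in_itv/= => /andP[h1 h2].
    by apply/andP; split; lra.
  rewrite /F; case: ifPn => // /asboolP[] y By; apply: dA; split => // i j.
  rewrite ord1 /ball/= /ball_ /=.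
  have := Bx j; have := By j; rewrite /= !in_itv/= => /andP[h1 h2] /andP[h3 h4].
  by rewrite ltr_norml; apply/andP; split; lra.
apply: countable_bigcupT_measurable; first exact: countableP.
move=> p; rewrite /F; case: ifPn => // _.
apply: (@measurable_rV_box R n (fun i => `]ratr (p.1 ord0 i) - e p.2, ratr (p.1 ord0 i) + e p.2[%classic)).
by move=> i; exact: measurable_itv.
Qed.

Lemma continuous_measurable_rV n (f : 'rV[R]_n -> R) :
  continuous f -> measurable_fun setT f.
Proof.
move=> cf; apply: (measurability _ (RGenOpens.measurableE R)).
move=> _ [_ [a [b ->] <-]]; rewrite setTI; apply: open_measurable_rV.
by apply: open_comp; [move=> + _; exact: cf|exact: interval_open].
Qed.

(** The bound is on each coordinate rather than on a norm, so that it passes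
    to the slices of a function when one coordinate is frozen. *)
Definition bounded_supp n (f : 'rV[R]_n -> R) :=
  exists M : R, forall (x : 'rV[R]_n) i, M < `|x ord0 i| -> f x = 0.

Definition Cc n (f : 'rV[R]_n -> R) := continuous f /\ bounded_supp f.

Lemma Cc_integrable n (f : 'rV[R]_n -> R) :
  Cc f -> (lebesgue_rV n).-integrable setT (EFin \o f).
Proof.
move=> [cf [M fM]].
pose B : set 'rV[R]_n := [set x | forall i, `[- M, M]%classic (x ord0 i)].
have mB : measurable B.
  by apply: (@measurable_rV_box R n (fun=> `[- M, M]%classic)).
have -> : EFin \o f = (EFin \o f) \_ B.
  apply/funext => x; rewrite patchE; case: ifPn => //.
  rewrite notin_setE => /existsNP[i /= xi]; rewrite (fM x i)//.
  by rewrite ltNge ler_norml; apply/negP; move: xi; rewrite in_itv/=.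
apply/(integrable_mkcond _ mB).
apply: measurable_bounded_integrable => //.
- have muB : lebesgue_rV n B = (\prod_(i < n) lebesgue_measure (`[(- M)%R, M]%classic : set R))%E.
    by apply: (@lebesgue_rV_box R n (fun=> `[- M, M]%classic)).
  apply: (@eq_ind_r _ _ (fun z => (z < +oo)%E) _ _ muB).
  rewrite -ge0_fin_numE; last by apply: prode_ge0 => i _; exact: measure_ge0.
  apply: prode_fin_num => i _.
  by rewrite lebesgue_measure_itv/=; case: ifPn.
- by apply: measurable_funTS; exact: continuous_measurable_rV.
- have cB : compact B.
    by apply: (@rV_compact R n (fun=> `[- M, M]%classic)) => _; exact: segment_compact.
  have /compact_bounded[K [_ KP]] :=
    continuous_compact (continuous_subspaceT cf) cB.
  exists K; split; first exact: num_real.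
  by move=> k Kk x Bx; apply: (KP _ Kk); exists x.
Qed.

Lemma integral_derive_line (G : R -> R) :
  (forall t, derivable G t 1) -> continuous G^`()%classic ->
  (exists M : R, forall t, M < `|t| -> G t = 0) ->
  (\int[@lebesgue_measure R]_t (G^`()%classic t)%:E = 0)%E.
Proof.
move=> dG cG [M GM].
pose b : R := `|M| + 1.
have b0 : 0 < b by rewrite ltr_pwDr.
have Mb : M < b by rewrite (le_lt_trans (ler_norm _))// ltrDl.
have Gb t : b <= `|t| -> G t = 0 by move=> bt; apply: GM; exact: lt_le_trans bt.
have G'b t : b < `|t| -> G^`()%classic t = 0.
  move=> bt; rewrite -(derive1_cst (0 : R) t).
  rewrite !derive1E; apply: near_eq_derive.
  have : \forall s \near t, b < `|s|.
    have := @norm_continuous _ R t.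
    by move/(cvgr_gt `|t|); exact.
  by apply: filterS => s /ltW /Gb.
transitivity (\int[@lebesgue_measure R]_(t in `[(- b)%R, b]) (G^`()%classic t)%:E)%E.
  rewrite [RHS]integral_mkcond; apply: eq_integral => t _.
  rewrite patchE; case: ifPn => //; rewrite notin_setE/= in_itv/= => h.
  by rewrite G'b// ltNge ler_norml; apply/negP.
rewrite (@continuous_FTC2 _ _ G).
- by rewrite !Gb ?normrN ?subee// ler_norm.
- by rewrite gtrN.
- exact: continuous_subspaceT.
- have cGG : continuous G.
    by move=> t; apply: differentiable_continuous; exact/derivable1_diffP.
  split=> [t _//||].
  + exact/cvg_at_right_filter/cGG.
  + exact/cvg_at_left_filter/cGG.
- by [].
Qed.

Lemma cons_rV_continuous n (t : R) : continuous (fun y : 'rV[R]_n => cons_rV (t, y)).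
Proof.
move=> y A /nbhs_ballP[e /= e0 eA].
apply: (filterS _ (nbhsx_ballx y e e0)) => z [_ yz]; apply: eA; split => // i j.
by rewrite !mxE; case: unliftP => [k _|_]/=; [exact: yz|exact: ballxx].
Qed.

Lemma cons_rVD n (t : R) (y : 'rV[R]_n) h j :
  cons_rV (t, h *: delta_mx ord0 j + y) =
  h *: delta_mx ord0 (lift ord0 j) + cons_rV (t, y).
Proof.
apply/rowP => i; rewrite !mxE ?eqxx /=.
case: unliftP => [k ->|->]/=; rewrite ?mxE/=.
  by rewrite (inj_eq lift_inj).
by rewrite mulr0 add0r.
Qed.

Lemma cons_rVD0 n (t h : R) (y : 'rV[R]_n) :
  cons_rV (h + t, y) = h *: delta_mx ord0 ord0 + cons_rV (t, y).
Proof.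
apply/rowP => i; rewrite !mxE ?eqxx /=.
case: unliftP => [k ->|->]/=; rewrite ?mxE/= ?eqxx ?mulr1//.
by rewrite mulr0 add0r.
Qed.

(** The measure in dimension [n + 1] is by definition the image of a product
    measure; this is the form in which Fubini's theorem applies to it. *)
Lemma integral_rV_cons n (f : 'rV[R]_n.+1 -> R) : Cc f ->
  ((@lebesgue_measure R) \x (lebesgue_rV n))%E.-integrable setT
     (EFin \o (f \o @cons_rV R n)) /\
  (\int[lebesgue_rV n.+1]_x (f x)%:E =
   \int[(@lebesgue_measure R) \x (lebesgue_rV n)]_p (f (cons_rV p))%:E)%E.
Proof.
move=> cf; have intf := Cc_integrable cf.
have /integrableP[mf _] := intf.
have int : ((@lebesgue_measure R) \x (lebesgue_rV n))%E.-integrable setT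
     (EFin \o (f \o @cons_rV R n)).
  apply/integrableP; split.
    apply/measurable_EFinP; exact: (measurableT_comp (continuous_measurable_rV cf.1) (@measurable_cons_rV R n)).
  move/integrableP : intf => [_].
  rewrite [X in (X < _)%E -> _](_ : _ =
    \int[pushforward (@lebesgue_measure R \x lebesgue_rV n) (@cons_rV R n)]_x
      `|(EFin \o f) x|)%E//.
  rewrite ge0_integral_pushforward//.
    exact: measurable_cons_rV.
  exact: measurableT_comp.
split => //.
rewrite [LHS](_ : _ = \int[pushforward (@lebesgue_measure R \x lebesgue_rV n)
  (@cons_rV R n)]_x ((EFin \o f) x))%E//.
rewrite integral_pushforward//; exact: measurable_cons_rV.
Qed.

Lemma cons_rV_continuousl n (y : 'rV[R]_n) :
  continuous (fun t : R => cons_rV (t, y)).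
Proof.
move=> t A /nbhs_ballP[e /= e0 eA].
apply: (filterS _ (nbhsx_ballx t e e0)) => s ts; apply: eA; split => // i j.
by rewrite !mxE; case: unliftP => [k _|_]/=; [exact: ballxx|exact: ts].
Qed.

(** By Fubini's theorem the variable [i] may be integrated first. When it is
    the first coordinate, the fundamental theorem of calculus concludes; otherwise
    the claim holds on every slice by induction on the dimension. *)
Lemma integral_partial n (f : 'rV[R]_n -> R) i :
  (forall x, derivable f x (delta_mx ord0 i)) -> Cc f -> Cc (partial i f) ->
  (\int[lebesgue_rV n]_x (partial i f x)%:E = 0)%E.
Proof.
elim: n f i => [f []//|n IH f i df [cf [M fM]] cdf].
have [int ->] := integral_rV_cons cdf.
have [cd [M' dfM]] := cdf.
have [j ij|i0] := unliftP ord0 i; last first.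
- rewrite -integral21_prod_meas1//.
  apply: integral0_eq => y _; rewrite /fubini_G/=.
  pose G t := f (cons_rV (t, y)).
  have eqq t : (fun h : R => h^-1 *: (G (h *: 1 + t) - G t)) =
    (fun h => h^-1 *: (f (h *: delta_mx ord0 i + cons_rV (t, y)) - f (cons_rV (t, y)))).
    by apply/funext => h; rewrite /G cons_rVD0 i0 [_ *: 1]mulr1.
  have eqp : G^`()%classic = (fun t => partial i f (cons_rV (t, y))).
    by apply/funext => t; rewrite derive1E /partial /derive /= eqq.
  rewrite -[RHS](@integral_derive_line G).
  + by apply: eq_integral => t _; rewrite eqp.
  + by move=> t; rewrite /derivable /= eqq; exact: df.
  + rewrite eqp => t; apply: continuous_comp; [exact: cons_rV_continuousl|exact: cd].
  + exists M => t Mt; apply: (fM _ ord0).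
    by rewrite mxE unlift_none.
- rewrite -integral12_prod_meas1//.
  apply: integral0_eq => t _; rewrite /fubini_F/=.
  pose G y := f (cons_rV (t, y)).
  have eqq y : (fun h : R => h^-1 *: (G (h *: delta_mx ord0 j + y) - G y)) =
    (fun h => h^-1 *: (f (h *: delta_mx ord0 i + cons_rV (t, y)) - f (cons_rV (t, y)))).
    by apply/funext => h; rewrite /G cons_rVD ij.
  have eqp : partial j G = (fun y => partial i f (cons_rV (t, y))).
    by apply/funext => y; rewrite /partial /derive /= eqq.
  rewrite -[RHS](IH G j).
  + by apply: eq_integral => y _; rewrite eqp.
  + by move=> y; rewrite /derivable /= eqq; exact: df.
  + split; first by move=> y; apply: continuous_comp; [exact: cons_rV_continuous|exact: cf].
    by exists M => y k Mt; apply: (fM _ (lift ord0 k)); rewrite mxE liftK.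
  + rewrite eqp; split.
      by move=> y; apply: continuous_comp; [exact: cons_rV_continuous|exact: cd].
    by exists M' => y k Mt; apply: (dfM _ (lift ord0 k)); rewrite mxE liftK.
Qed.

End rV_measure.

(** * Smooth functions *)

Section smooth_algebra.
Context {R : realType} {N : nat}.
Local Notation V := 'rV[R]_N.
Implicit Types (f g u : V -> R) (x : V) (i j : 'I_N).

Lemma partialD i f g x : differentiable f x -> differentiable g x ->
  partial i (fun y => f y + g y) x = partial i f x + partial i g x.
Proof. by move=> df dg; rewrite /partial deriveD//; exact: diff_derivable. Qed.

Lemma partialM i f g x : differentiable f x -> differentiable g x ->
  partial i (fun y => f y * g y) x = partial i f x * g x + f x * partial i g x.
Proof.
move=> df dg; rewrite /partial deriveM; [|exact: diff_derivable..].
by rewrite addrC mulrC.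
Qed.

Lemma partial_cst i (c : R) x : partial i (fun=> c) x = 0.
Proof. exact: derive_cst. Qed.

Lemma coord_differentiable j x : differentiable (fun y : V => y ord0 j) x.
Proof. exact: differentiable_coord. Qed.

(** [smooth] speaks of iterated derivatives, so that a direct induction for a
    product would have to carry the Leibniz formula. This class is instead closed
    under [partial] one step at a time, which is enough. *)
Inductive smooth_alg : (V -> R) -> Prop :=
| alg_smooth u : smooth u -> smooth_alg u
| alg_cst c : smooth_alg (fun=> c)
| alg_coord j : smooth_alg (fun y => y ord0 j)
| alg_add f g : smooth_alg f -> smooth_alg g -> smooth_alg (fun y => f y + g y)
| alg_mul f g : smooth_alg f -> smooth_alg g -> smooth_alg (fun y => f y * g y).

Lemma smooth_differentiable u x : smooth u -> differentiable u x.
Proof. by move/(_ [::]). Qed.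

Lemma smooth_partial u i : smooth u -> smooth (partial i u).
Proof. by move=> su s x; have := su (rcons s i) x; rewrite foldr_rcons. Qed.

Lemma partial_coord i j x : partial i (fun y : V => y ord0 j) x = (i == j)%:R.
Proof.
rewrite /partial /derive.
apply: lim_near_cst => //; near=> h.
rewrite /= !mxE ?eqxx/= addrK [_ *: _]mulrA mulVf ?mul1r; first by rewrite eq_sym.
by near: h; exact: nbhs_dnbhs_neq.
Unshelve. all: by end_near. Qed.

Lemma smooth_algP f : smooth_alg f ->
  (forall x, differentiable f x) /\ forall i, smooth_alg (partial i f).
Proof.
elim=> {f} [u su|c|j|f g sf [df pf] sg [dg pg]|f g sf [df pf] sg [dg pg]]; split.
- by move=> x; exact: smooth_differentiable.
- by move=> i; apply/alg_smooth/smooth_partial.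
- by move=> x; exact: differentiable_cst.
- move=> i; rewrite (_ : partial i _ = fun=> 0); first exact: alg_cst.
  by apply/funext => x; exact: partial_cst.
- by move=> x; exact: coord_differentiable.
- move=> i; rewrite (_ : partial i _ = fun=> (i == j)%:R); first exact: alg_cst.
  by apply/funext => x; exact: partial_coord.
- by move=> x; exact: differentiableD.
- move=> i.
  rewrite (_ : partial i _ = fun y => partial i f y + partial i g y).
    exact: alg_add.
  by apply/funext => x; exact: partialD.
- by move=> x; exact: differentiableM.
- move=> i.
  rewrite (_ : partial i _ = fun y => partial i f y * g y + f y * partial i g y).
    by apply: alg_add; exact: alg_mul.
  by apply/funext => x; exact: partialM.
Qed.

Lemma smooth_alg_smooth f : smooth_alg f -> smooth f.
Proof.
move=> af s x.
suff : smooth_alg (foldr partial f s) by move/smooth_algP => [].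
by elim: s => // i s /smooth_algP[_]; exact.
Qed.

Lemma smoothD f g : smooth f -> smooth g -> smooth (fun y => f y + g y).
Proof. by move=> sf sg; apply/smooth_alg_smooth/alg_add; exact: alg_smooth. Qed.

Lemma smoothM f g : smooth f -> smooth g -> smooth (fun y => f y * g y).
Proof. by move=> sf sg; apply/smooth_alg_smooth/alg_mul; exact: alg_smooth. Qed.

Lemma smooth_cst c : smooth (fun _ : V => c).
Proof. exact/smooth_alg_smooth/alg_cst. Qed.

Lemma smooth_coord j : smooth (fun y : V => y ord0 j).
Proof. exact/smooth_alg_smooth/alg_coord. Qed.

Lemma smoothN f : smooth f -> smooth (fun y => - f y).
Proof.
move=> sf; rewrite (_ : (fun y => - f y) = fun y => -1 * f y).
  by apply: smoothM => //; exact: smooth_cst.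
by apply/funext => y; rewrite mulN1r.
Qed.

Lemma smoothB f g : smooth f -> smooth g -> smooth (fun y => f y - g y).
Proof. by move=> sf sg; apply: smoothD => //; exact: smoothN. Qed.

Lemma smooth_sum (I : Type) (s : seq I) (F : I -> V -> R) :
  (forall k, smooth (F k)) -> smooth (fun y => \sum_(k <- s) F k y).
Proof.
move=> sF; elim: s => [|k s IH].
  by under [X in smooth X]eq_fun do rewrite big_nil; exact: smooth_cst.
by under [X in smooth X]eq_fun do rewrite big_cons; exact: smoothD.
Qed.

Lemma smooth_continuous u : smooth u -> continuous u.
Proof. by move=> su x; exact/differentiable_continuous/smooth_differentiable. Qed.

Lemma partial_sum (I : Type) (s : seq I) (F : I -> V -> R) i x :
  (forall k, smooth (F k)) ->
  partial i (fun y => \sum_(k <- s) F k y) x = \sum_(k <- s) partial i (F k) x.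
Proof.
move=> sF; elim: s => [|k s IH].
  by under [X in partial _ X]eq_fun do rewrite big_nil; rewrite big_nil partial_cst.
under [X in partial _ X]eq_fun do rewrite big_cons.
rewrite partialD ?IH ?big_cons//; first exact: smooth_differentiable.
by apply: smooth_differentiable; exact: smooth_sum.
Qed.

Lemma line_is_derive f x (v : V) (s : R) : (forall y, differentiable f y) ->
  is_derive s 1 (fun s => f (x + s *: v)) ('D_v f (x + s *: v)).
Proof.
move=> df.
have eqq : (fun h : R => h^-1 *: (f (x + (h *: 1 + s) *: v) - f (x + s *: v))) =
  (fun h => h^-1 *: (f (h *: v + (x + s *: v)) - f (x + s *: v))).
  by apply/funext => h; rewrite scalerDl [h *: 1]mulr1 addrCA.
apply: DeriveDef; last by rewrite /derive /= eqq.
by rewrite /derivable /= eqq; exact: (@diff_derivable _ _ _ f).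
Qed.

Lemma line_MVT f x (v : V) (t : R) : 0 < t -> (forall y, differentiable f y) ->
  exists2 s, 0 < s < t & f (x + t *: v) - f x = t * 'D_v f (x + s *: v).
Proof.
move=> t0 df.
have [|s st E] := @MVT _ (fun s => f (x + s *: v)) (fun s => 'D_v f (x + s *: v))
  0 t t0 (fun s _ => line_is_derive x v s df).
  apply: derivable_within_continuous => s _.
  by case: (line_is_derive x v s df).
exists s; first by move: st; rewrite in_itv.
by rewrite subr0 scale0r addr0 in E; rewrite E mulrC.
Qed.

(** Two applications of the mean value theorem. Exchanging [v] and [w] leaves
    the second difference unchanged, which is why it compares the two mixed
    derivatives. *)
Lemma second_difference u x (v w : V) (t : R) : 0 < t ->
  (forall y, differentiable u y) -> (forall y, differentiable ('D_v u) y) ->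
  exists2 c, 0 < c.1 < t /\ 0 < c.2 < t &
    u (x + t *: v + t *: w) - u (x + t *: v) - (u (x + t *: w) - u x) =
    t ^+ 2 * 'D_w ('D_v u) (x + c.1 *: v + c.2 *: w).
Proof.
move=> t0 du ddu.
pose g y := u (y + t *: w) - u y.
have dsh y : differentiable (fun z => u (z + t *: w)) y.
  have dz : differentiable (fun z : V => z + t *: w) y.
    exact: (@differentiableD _ _ _ id (cst (t *: w))).
  exact: (differentiable_comp dz (du _)).
have dg y : differentiable g y by apply: differentiableB.
have Dg y : 'D_v g y = 'D_v u (y + t *: w) - 'D_v u y.
  rewrite (_ : g = (fun z => u (z + t *: w)) - u)//.
  rewrite deriveB; [|exact: (diff_derivable (dsh y))|exact: (diff_derivable (du y))].
  congr (_ - _).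
  have eqq : (fun h : R => h^-1 *: (u (h *: v + y + t *: w) - u (y + t *: w))) =
             (fun h => h^-1 *: (u (h *: v + (y + t *: w)) - u (y + t *: w))).
    by apply/funext => h; rewrite addrA.
  by rewrite /derive /= eqq.
have [s st] := line_MVT x v t0 dg; rewrite Dg => E1.
have [s' st' E2] := line_MVT (x + s *: v) w t0 ddu.
exists (s, s') => //.
by rewrite expr2 -mulrA -E2 -E1.
Qed.

(** The same second difference is [t ^ 2] times either mixed derivative, taken
    at two points that tend to [x] with [t]. *)
Lemma partialC u i j x : smooth u ->
  partial i (partial j u) x = partial j (partial i u) x.
Proof.
move=> su.
pose v : V := delta_mx ord0 i; pose w : V := delta_mx ord0 j.
pose F := partial i (partial j u); pose G := partial j (partial i u).
have cF : {for x, continuous F} by apply: smooth_continuous; do 2 apply: smooth_partial.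
have cG : {for x, continuous G} by apply: smooth_continuous; do 2 apply: smooth_partial.
apply/eqP; rewrite -subr_eq0 -normr_le0; apply/ler_addgt0Pr => e e0; rewrite add0r.
have e2 : 0 < e / 2 by rewrite divr_gt0.
move/cvgrPdist_lt : cF => /(_ _ e2) /nbhs_ballP[d /= d0 dF].
move/cvgrPdist_lt : cG => /(_ _ e2) /nbhs_ballP[d' /= d'0 dG].
(* The two points at which the mixed derivatives are compared are then within
   [Num.min d d'] of [x]. *)
pose t := Num.min d d' / (`|v| + `|w| + 1).
have c0 : 0 < `|v| + `|w| + 1 by rewrite ltr_pwDr// addr_ge0.
have t0 : 0 < t by rewrite divr_gt0// lt_min d0.
have near (c1 c2 : R) v' w' : `|v'| + `|w'| = `|v| + `|w| -> 0 < c1 < t -> 0 < c2 < t ->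
    `|x - (x + c1 *: v' + c2 *: w')| < Num.min d d'.
  move=> vw /andP[c10 c1t] /andP[c20 c2t].
  rewrite -addrA opprD addNKr normrN.
  rewrite (le_lt_trans (ler_normD _ _))// !normrZ (gtr0_norm c10) (gtr0_norm c20).
  rewrite (@le_lt_trans _ _ (t * (`|v'| + `|w'|)))//.
    by rewrite mulrDr lerD// ler_wpM2r// ltW.
  by rewrite vw -[ltRHS](divfK (lt0r_neq0 c0)) ltr_pM2l// ltrDl.
have du y : differentiable u y by exact: smooth_differentiable.
have [c [c1 c2] E] := @second_difference u x w v t t0 du
  (fun y => smooth_differentiable y (smooth_partial j su)).
have [c' [c1' c2'] E'] := @second_difference u x v w t t0 du
  (fun y => smooth_differentiable y (smooth_partial i su)).
have {E E'} EFG : F (x + c.1 *: w + c.2 *: v) = G (x + c'.1 *: v + c'.2 *: w).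
  apply: (mulfI (_ : t ^+ 2 != 0)); first by rewrite expf_neq0// gt_eqF.
  have swap (a1 a2 a3 a4 : R) : a1 - a2 - (a3 - a4) = a1 - a3 - (a2 - a4) by ring.
  by rewrite -[LHS]E -[RHS]E' [x + t *: w + _]addrAC swap.
have HF : `|F x - F (x + c.1 *: w + c.2 *: v)| < e / 2.
  apply: dF; rewrite -ball_normE /ball_ /=.
  by have := near c.1 c.2 w v (addrC _ _) c1 c2; rewrite lt_min => /andP[].
have HG : `|G x - G (x + c'.1 *: v + c'.2 *: w)| < e / 2.
  apply: dG; rewrite -ball_normE /ball_ /=.
  by have := near c'.1 c'.2 v w erefl c1' c2'; rewrite lt_min => /andP[].
rewrite -/F -/G.
rewrite EFG in HF.
move: (F x) (G x) (G _) HF HG => a b c3 HF HG.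
have -> : a - b = (a - c3) - (b - c3) by ring.
apply: (le_trans (ler_normB _ _)); rewrite [leRHS]splitr; apply: lerD; exact: ltW.
Qed.

Definition sqn x : R := \sum_k x ord0 k ^+ 2.

Lemma sqn_ge0 x : 0 <= sqn x.
Proof. by apply: sumr_ge0 => k _; exact: sqr_ge0. Qed.

Lemma smooth_sqn : smooth sqn.
Proof. by apply: smooth_sum => k; apply: smoothM; exact: smooth_coord. Qed.

Lemma partial_sqn i x : partial i sqn x = 2 * x ord0 i.
Proof.
rewrite partial_sum; last by move=> k; apply: smoothM; exact: smooth_coord.
under eq_bigr => k _.
  rewrite (_ : partial i _ x = (i == k)%:R * (2 * x ord0 k)); last first.
    rewrite partialM ?partial_coord; [ring|exact: coord_differentiable..].
  over.
rewrite (bigD1 i)//= eqxx mul1r big1 ?addr0// => k /negbTE ki.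
by rewrite eq_sym ki mul0r.
Qed.

Lemma partial_radial (Phi : R -> R) (dPhi : R) i x :
  is_derive (sqn x) 1 Phi dPhi ->
  differentiable (fun y => Phi (sqn y)) x /\
  partial i (fun y => Phi (sqn y)) x = 2 * x ord0 i * dPhi.
Proof.
move=> [dP DP].
have dP' : differentiable Phi (sqn x) by exact/derivable1_diffP.
have ds := smooth_differentiable x smooth_sqn.
have dc := differentiable_comp ds dP'; split => //.
have Hd : 'd sqn x (delta_mx ord0 i) = 2 * x ord0 i.
  by rewrite -deriveE//; exact: partial_sqn.
rewrite /partial (deriveE _ dc) (diff_comp ds dP')/= Hd.
by rewrite deriv1E// derive1E DP.
Qed.

End smooth_algebra.

(** * Sums over pairs of coordinates *)

Section tensor_algebra.
Context {R : realFieldType} {N : nat}.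
Implicit Types (a b c d p x z : 'I_N -> R) (h : 'I_N -> 'I_N -> R).

Lemma sum_deltal (f : 'I_N -> R) k : \sum_l (k == l)%:R * f l = f k.
Proof.
rewrite (bigD1 k)//= eqxx mul1r big1 ?addr0// => l /negbTE lk.
by rewrite eq_sym lk mul0r.
Qed.

Lemma sum_deltar (f : 'I_N -> R) k : \sum_l (l == k)%:R * f l = f k.
Proof. by under eq_bigr do rewrite eq_sym; exact: sum_deltal. Qed.

Lemma sum_prod a b : \sum_k \sum_l a k * b l = (\sum_k a k) * (\sum_l b l).
Proof. by rewrite big_distrlr. Qed.

Definition dot a b := \sum_k a k * b k.

Lemma dotC a b : dot a b = dot b a.
Proof. by apply: eq_bigr => k _; rewrite mulrC. Qed.

(** This is the Binet-Cauchy identity; all sums over pairs of rotations below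
    are evaluated with it. *)
Lemma wedge_dot a b c d :
  \sum_k \sum_l (a k * b l - a l * b k) * (c k * d l - c l * d k) =
  2 * (dot a c * dot b d - dot a d * dot b c).
Proof.
transitivity (\sum_k \sum_l (a k * c k) * (b l * d l)
  - \sum_k \sum_l (a k * d k) * (b l * c l)
  - \sum_k \sum_l (b k * c k) * (a l * d l)
  + \sum_k \sum_l (b k * d k) * (a l * c l)).
  rewrite -!sumrB -big_split/=; apply: eq_bigr => k _.
  rewrite -!sumrB -big_split/=; apply: eq_bigr => l _; ring.
by rewrite !sum_prod -!/(dot _ _); ring.
Qed.

Lemma wedge_sqr a b :
  \sum_k \sum_l (a k * b l - a l * b k) ^+ 2 = 2 * (dot a a * dot b b - dot a b ^+ 2).
Proof. by under eq_bigr do under eq_bigr do rewrite expr2; rewrite wedge_dot (dotC b); ring. Qed.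

(** For a symmetric [h], the traceless part of the compression of [h] to the
    hyperplane orthogonal to [x] has nonnegative norm; the matrix [M] below is
    that part, multiplied by [dot x x]. *)
Lemma compression_trace x h z : (1 < N)%N -> (forall k l, h k l = h l k) ->
  (forall l, z l = \sum_k x k * h k l) ->
  (dot x x * (\sum_k h k k) - dot x z) ^+ 2 <=
  (N%:R - 1) * (dot x x ^+ 2 * (\sum_k \sum_l h k l ^+ 2)
                - 2 * dot x x * dot z z + dot x z ^+ 2).
Proof.
move=> N1 hC zl.
have N10 : 0 < N%:R - 1 :> R by rewrite subr_gt0 ltr1n.
set X := dot x x; set t := \sum_k h k k; set F := \sum_k \sum_l h k l ^+ 2.
set q := dot x z; set Z := dot z z.
have [X0|X0] := eqVneq X 0.
  have x0 k : x k = 0.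
    have /psumr_eq0P := X0 => /(_ (fun k _ => sqr_ge0 (x k))).
    by move=> /(_ k isT)/eqP; rewrite mulf_eq0 orbb => /eqP.
  have -> : q = 0 by rewrite /q /dot big1// => k _; rewrite x0 mul0r.
  by rewrite X0 !mul0r; lra.
(* [tau] makes [M] traceless and [b] makes it vanish on [x]. *)
pose tau := (X * t - q) / (N%:R - 1).
pose b := (q + tau) / X.
pose M k l := X * h k l - x k * z l - z k * x l + b * (x k * x l) - tau * (k == l)%:R.
have : 0 <= \sum_k \sum_l M k l ^+ 2.
  by apply: sumr_ge0 => k _; apply: sumr_ge0 => l _; exact: sqr_ge0.
have zE k : \sum_l h k l * x l = z k.
  by rewrite zl; apply: eq_bigr => l _; rewrite hC mulrC.
have hxz : \sum_k \sum_l h k l * (x k * z l) = Z.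
  rewrite exchange_big; apply: eq_bigr => l _; rewrite {2}zl big_distrl/=.
  by apply: eq_bigr => k _; ring.
have hzx : \sum_k \sum_l h k l * (z k * x l) = Z.
  apply: eq_bigr => k _; rewrite -{3}(zE k) big_distrr/=.
  by apply: eq_bigr => l _; ring.
have hxx : \sum_k \sum_l h k l * (x k * x l) = q.
  apply: eq_bigr => k _; rewrite -[in RHS](zE k) big_distrr/=.
  by apply: eq_bigr => l _; ring.
have hd : \sum_k \sum_l (k == l)%:R * h k l = t.
  by apply: eq_bigr => k _; exact: sum_deltal.
have dd : \sum_(k < N) \sum_(l < N) (k == l)%:R * (1:R) = N%:R.
  by under eq_bigr do rewrite (sum_deltal (fun=> 1)); rewrite sumr_const card_ord.
have ad a c : \sum_k \sum_l (k == l)%:R * (a k * c l) = dot a c.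
  by apply: eq_bigr => k _; rewrite (sum_deltal (fun l => a k * c l)).
have ac a c a' c' : \sum_k \sum_l (a k * a' k) * (c l * c' l) = dot a a' * dot c c'.
  exact: sum_prod.
have -> : \sum_k \sum_l M k l ^+ 2 =
  X ^+ 2 * F + dot x x * dot z z + dot z z * dot x x + b ^+ 2 * (dot x x * dot x x)
  + tau ^+ 2 * N%:R - 2 * X * Z - 2 * X * Z + 2 * X * b * q - 2 * X * tau * t
  + 2 * (dot x z * dot z x) - 2 * b * (dot x x * dot z x) + 2 * tau * dot x z
  - 2 * b * (dot z x * dot x x) + 2 * tau * dot z x - 2 * b * tau * dot x x.
  clearbody tau b X q t Z.
  rewrite -!ac -!ad -hd -dd -{1}hxz -hzx -hxx /F.
  rewrite !mulr_sumr -!sumrN -!big_split/=; apply: eq_bigr => k _.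
  rewrite !mulr_sumr -!sumrN -!big_split/=; apply: eq_bigr => l _.
  rewrite /M; have [->|kl] := eqVneq k l; rewrite ?eqxx ?(negbTE kl) /=; ring.
rewrite (dotC z x) -/X -/Z -/q.
have bX : b * X = q + tau by rewrite /b divfK.
have tN : tau * (N%:R - 1) = X * t - q by rewrite /tau divfK// gt_eqF.
set G := (X in 0 <= X -> _).
have -> : G = X ^+ 2 * F - 2 * X * Z + q ^+ 2 - tau * (X * t - q).
  rewrite /G -tN.
  have -> : b ^+ 2 * (X * X) = (b * X) ^+ 2 by ring.
  have -> : 2 * X * b * q = 2 * (b * X) * q by ring.
  have -> : 2 * b * (X * q) = 2 * (b * X) * q by ring.
  have -> : 2 * b * (q * X) = 2 * (b * X) * q by ring.
  have -> : 2 * b * tau * X = 2 * (b * X) * tau by ring.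
  have -> : 2 * X * tau * t = 2 * tau * (tau * (N%:R - 1) + q) by rewrite tN; ring.
  rewrite bX; ring.
move=> G0.
have : 0 <= (N%:R - 1) * (X ^+ 2 * F - 2 * X * Z + q ^+ 2 - tau * (X * t - q)).
  by apply: mulr_ge0 => //; exact: ltW.
rewrite mulrBr mulrA [_ * tau]mulrC tN subr_ge0 expr2; apply: le_trans.
by [].
Qed.

End tensor_algebra.

(** * The Euler field, the rotations and the spherical Laplacian *)

Section operators.
Context {R : realType} {N : nat}.
Local Notation V := 'rV[R]_N.
Implicit Types (f g u : V -> R) (x : V) (i j k l : 'I_N).

(** A sealed copy of [partial]: unification must not unfold the limit that
    defines the derivative. *)
Definition pd : 'I_N -> (V -> R) -> V -> R := locked (@partial R N).

Lemma pdE : pd = @partial R N.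
Proof. by rewrite /pd -lock. Qed.

Lemma smooth_pd i u : smooth u -> smooth (pd i u).
Proof. by rewrite pdE; exact: smooth_partial. Qed.

Lemma pd_sum (I : Type) (s : seq I) (F : I -> V -> R) i x :
  (forall k : I, smooth (F k)) ->
  pd i (fun y => \sum_(k <- s) F k y) x = \sum_(k <- s) pd i (F k) x.
Proof. by rewrite pdE; exact: partial_sum. Qed.

Lemma pd_cst i (c : R) x : pd i (fun=> c) x = 0.
Proof. by rewrite pdE partial_cst. Qed.

Lemma pd_coord i j x : pd i (fun y : V => y ord0 j) x = (i == j)%:R.
Proof. by rewrite pdE partial_coord. Qed.

Lemma pd_sqn i x : pd i sqn x = 2 * x ord0 i.
Proof. by rewrite pdE partial_sqn. Qed.

Lemma pdC u i j x : smooth u -> pd i (pd j u) x = pd j (pd i u) x.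
Proof. by rewrite pdE; exact: partialC. Qed.

Lemma pdD f g i x : smooth f -> smooth g ->
  pd i (fun y => f y + g y) x = pd i f x + pd i g x.
Proof. by rewrite pdE => sf sg; apply: partialD; exact: smooth_differentiable. Qed.

Lemma pdM f g i x : smooth f -> smooth g ->
  pd i (fun y => f y * g y) x = pd i f x * g x + f x * pd i g x.
Proof. by rewrite pdE => sf sg; apply: partialM; exact: smooth_differentiable. Qed.

Definition lapl u x : R := \sum_i pd i (pd i u) x.

Definition euler u x : R := \sum_k x ord0 k * pd k u x.

(** The rotation field in the plane of the coordinates [i] and [j]. Both
    [rot i j] and [rot j i] occur in the sums below, and [rot i i] vanishes; this
    is the origin of the factors [2^-1]. *)
Definition rot i j u x : R := x ord0 i * pd j u x - x ord0 j * pd i u x.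

(** The Laplacian of the sphere, as the Casimir element of the rotations; it
    avoids any parametrization of the sphere. *)
Definition sphlap u x : R := 2^-1 * \sum_i \sum_j rot i j (rot i j u) x.

Definition gradsq u x : R := \sum_k pd k u x ^+ 2.

Lemma smooth_euler u : smooth u -> smooth (euler u).
Proof.
by move=> su; apply: smooth_sum => k; apply: smoothM; [exact: smooth_coord|exact: smooth_pd].
Qed.

Lemma smooth_rot i j u : smooth u -> smooth (rot i j u).
Proof.
by move=> su; apply: smoothB; apply: smoothM; [exact: smooth_coord|exact: smooth_pd|
  exact: smooth_coord|exact: smooth_pd].
Qed.

Lemma smooth_lapl u : smooth u -> smooth (lapl u).
Proof. by move=> su; apply: smooth_sum => i; do 2 apply: smooth_pd. Qed.

Lemma pdZ (c : R) f i x : smooth f ->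
  pd i (fun y => c * f y) x = c * pd i f x.
Proof.
move=> sf; rewrite (@pdM (fun=> c)) ?pd_cst ?mul0r ?add0r//.
exact: smooth_cst.
Qed.

Lemma pdB f g i x : smooth f -> smooth g ->
  pd i (fun y => f y - g y) x = pd i f x - pd i g x.
Proof.
move=> sf sg; rewrite (@pdD f (fun y => - g y))//; last exact: smoothN.
congr (_ + _); rewrite -[RHS]mulN1r -pdZ//; congr (pd _ _ _).
by apply/funext => y; rewrite mulN1r.
Qed.

Lemma pd_coordM f i j x : smooth f ->
  pd i (fun y => y ord0 j * f y) x = (i == j)%:R * f x + x ord0 j * pd i f x.
Proof.
move=> sf; rewrite (@pdM (fun y => y ord0 j))//; last exact: smooth_coord.
by rewrite pd_coord.
Qed.

Lemma pd_euler u k x : smooth u ->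
  pd k (euler u) x =
  pd k u x + \sum_l x ord0 l * pd k (pd l u) x.
Proof.
move=> su; rewrite pd_sum; last first.
  by move=> l; apply: smoothM; [exact: smooth_coord|exact: smooth_pd].
under eq_bigr do rewrite (pd_coordM _ _ _ (smooth_pd _ su)).
by rewrite big_split/= sum_deltal.
Qed.

Lemma pd_rot u i j k x : smooth u ->
  pd k (rot i j u) x =
  (k == i)%:R * pd j u x + x ord0 i * pd k (pd j u) x
  - ((k == j)%:R * pd i u x + x ord0 j * pd k (pd i u) x).
Proof.
move=> su; have sp l := smooth_pd l su.
rewrite (@pdB (fun y => y ord0 i * pd j u y) (fun y => y ord0 j * pd i u y)).
- by rewrite (pd_coordM _ _ _ (sp _)) (pd_coordM _ _ _ (sp _)).
- by apply: smoothM => //; exact: smooth_coord.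
- by apply: smoothM => //; exact: smooth_coord.
Qed.

Lemma euler_euler u x : smooth u ->
  euler (euler u) x = euler u x +
  \sum_k \sum_l pd k (pd l u) x * (x ord0 k * x ord0 l).
Proof.
move=> su; rewrite {1}/euler.
under eq_bigr do rewrite pd_euler// mulrDr.
rewrite big_split/=; congr (_ + _); apply: eq_bigr => k _.
by rewrite big_distrr/=; apply: eq_bigr => l _; ring.
Qed.

Lemma sphlapE u x : smooth u ->
  sphlap u x = sqn x * lapl u x
    - \sum_k \sum_l pd k (pd l u) x * (x ord0 k * x ord0 l)
    - (N%:R - 1) * euler u x.
Proof.
move=> su; rewrite /sphlap.
set q := \sum_k \sum_l pd k (pd l u) x * _.
pose p k := pd k u x; pose h k l := pd k (pd l u) x.
have dxp : \sum_i \sum_j (i == j)%:R * (x ord0 i * p j) = euler u x.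
  by apply: eq_bigr => i _; rewrite (sum_deltal (fun j => x ord0 i * p j)).
have E1 : \sum_i \sum_(j < N) (x ord0 i * p i) * 1 = euler u x * N%:R.
  by rewrite sum_prod sumr_const card_ord.
have E2 : \sum_(i < N) \sum_j 1 * (x ord0 j * p j) = N%:R * euler u x.
  by rewrite sum_prod sumr_const card_ord.
have E3 : \sum_i \sum_j (x ord0 i ^+ 2) * h j j = sqn x * lapl u x.
  by rewrite sum_prod.
have E4 : \sum_i \sum_j h i i * (x ord0 j ^+ 2) = lapl u x * sqn x.
  by rewrite sum_prod.
have -> : \sum_i \sum_j rot i j (rot i j u) x =
  euler u x + sqn x * lapl u x - euler u x * N%:R - q
  - N%:R * euler u x - q + euler u x + lapl u x * sqn x.
  rewrite -E1 -E2 -E3 -E4 -!dxp /q -!sumrN -!big_split/=; apply: eq_bigr => i _.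
  rewrite -!sumrN -!big_split/=; apply: eq_bigr => j _.
  rewrite {1}/rot !pd_rot// !eqxx -/(p i) -/(p j) -!/(h _ _).
  have -> : h j i = h i j by exact: pdC.
  have [->|ij] := eqVneq i j; rewrite ?eqxx 1?eq_sym ?(negbTE ij)/=.
    by move: (h j j) (p j) (x ord0 j) => *; ring.
  by move: (h i j) (h i i) (h j j) (p i) (p j) (x ord0 i) (x ord0 j) => *; ring.
by field.
Qed.

(** This is the expression of the Laplacian in polar coordinates, freed of
    denominators. *)
Lemma sqn_lapl u x : smooth u ->
  sqn x * lapl u x =
  euler (euler u) x + (N%:R - 2) * euler u x + sphlap u x.
Proof. by move=> su; rewrite sphlapE// euler_euler//; ring. Qed.

Lemma euler_rot u i j x : smooth u ->
  euler (rot i j u) x = rot i j (euler u) x.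
Proof.
move=> su; rewrite /euler; under eq_bigr do rewrite pd_rot//.
rewrite /rot !pd_euler//.
transitivity (\sum_k ((k == i)%:R * (x ord0 k * pd j u x)
  - (k == j)%:R * (x ord0 k * pd i u x))
  + (x ord0 i * (\sum_k x ord0 k * pd j (pd k u) x)
  - x ord0 j * (\sum_k x ord0 k * pd i (pd k u) x))).
  rewrite 2!big_distrr -sumrB -big_split/=; apply: eq_bigr => k _.
  rewrite (pdC k j x su) (pdC k i x su).
  move: (pd j (pd k u) x) (pd i (pd k u) x) (pd i u x)
    (pd j u x) (x ord0 k) (x ord0 i) (x ord0 j) => *; ring.
rewrite sumrB (sum_deltar (fun k => x ord0 k * pd j u x))
  (sum_deltar (fun k => x ord0 k * pd i u x)).
have aux (a b c d e f : R) : a * b - c * d + (a * e - c * f) = a * (b + e) - c * (d + f) by ring.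
exact: aux.
Qed.

Lemma lapl_rot u i j x : smooth u ->
  lapl (rot i j u) x = rot i j (lapl u) x.
Proof.
move=> su.
have sp k := smooth_pd k su.
have spp k l := smooth_pd k (sp l).
have pp a y : pd a (lapl u) y = \sum_k pd k (pd k (pd a u)) y.
  rewrite /lapl pd_sum; last by move=> k; do 2 apply: smooth_pd.
  apply: eq_bigr => k _.
  have E : pd a (pd k u) = pd k (pd a u).
    by apply/funext => z; exact: pdC.
  by rewrite (pdC a k y (sp k)) E.
have pr k : pd k (rot i j u) = (fun y => ((k == i)%:R * pd j u y
    - (k == j)%:R * pd i u y)
    + (y ord0 i * pd k (pd j u) y - y ord0 j * pd k (pd i u) y)).
  apply/funext => y; rewrite (pd_rot i j k y su).
  have aux (a b c d : R) : a + b - (c + d) = a - c + (b - d) by ring.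
  exact: aux.
pose f1 k (y : V) := (k == i)%:R * pd j u y - (k == j)%:R * pd i u y.
pose f2 k (y : V) := y ord0 i * pd k (pd j u) y - y ord0 j * pd k (pd i u) y.
have sf1 k : smooth (f1 k).
  by apply: smoothB; apply: smoothM; [exact: smooth_cst|exact: sp|exact: smooth_cst|exact: sp].
have sf2 k : smooth (f2 k).
  by apply: smoothB; apply: smoothM; [exact: smooth_coord|exact: spp|exact: smooth_coord|exact: spp].
have d1 k : pd k (f1 k) x = (k == i)%:R * pd k (pd j u) x
    - (k == j)%:R * pd k (pd i u) x.
  rewrite (@pdB (fun y => (k == i)%:R * pd j u y)
    (fun y => (k == j)%:R * pd i u y)).
  - by rewrite (pdZ (k == i)%:R k x (sp j)) (pdZ (k == j)%:R k x (sp i)).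
  - by apply: smoothM; [exact: smooth_cst|exact: sp].
  - by apply: smoothM; [exact: smooth_cst|exact: sp].
have d2 k : pd k (f2 k) x =
    (k == i)%:R * pd k (pd j u) x + x ord0 i * pd k (pd k (pd j u)) x
    - ((k == j)%:R * pd k (pd i u) x + x ord0 j * pd k (pd k (pd i u)) x).
  rewrite (@pdB (fun y => y ord0 i * pd k (pd j u) y)
    (fun y => y ord0 j * pd k (pd i u) y)).
  - have e1 := pd_coordM k i x (spp k j). have e2 := pd_coordM k j x (spp k i).
    by rewrite e1 e2.
  - by apply: smoothM; [exact: smooth_coord|exact: spp].
  - by apply: smoothM; [exact: smooth_coord|exact: spp].
transitivity (\sum_k ((k == i)%:R * (2 * pd k (pd j u) x)
  - (k == j)%:R * (2 * pd k (pd i u) x)) + \sum_k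
  (x ord0 i * pd k (pd k (pd j u)) x -
   x ord0 j * pd k (pd k (pd i u)) x)).
  rewrite -big_split/=; apply: eq_bigr => k _.
  rewrite pr (pdD k x (sf1 k) (sf2 k)) d1 d2.
  have aux (a b c d e f g h : R) : a * b - c * d + (a * b + e * f - (c * d + g * h)) =
    a * (2 * b) - c * (2 * d) + (e * f - g * h) by ring.
  exact: aux.
rewrite sumrB (sum_deltar (fun k => 2 * pd k (pd j u) x))
  (sum_deltar (fun k => 2 * pd k (pd i u) x)) (pdC i j x su) subrr add0r.
by rewrite /rot (pp j x) (pp i x) 2!big_distrr -sumrB.
Qed.

Lemma rot_sqnM f i j x : smooth f ->
  rot i j (fun y => sqn y * f y) x = sqn x * rot i j f x.
Proof.
move=> sf; rewrite /rot !(@pdM sqn)//; try exact: smooth_sqn.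
by rewrite !pd_sqn; ring.
Qed.

(** Rather than from the commutators of the rotations, this follows from
    [sqn_lapl], because a rotation commutes with each of the other terms of that
    identity. *)
Lemma sphlap_rot u i j x : smooth u ->
  sphlap (rot i j u) x = rot i j (sphlap u) x.
Proof.
move=> su; have sr := smooth_rot i j su.
have sE := smooth_euler su; have sEE := smooth_euler sE.
have sL := smooth_lapl su.
have -> : sphlap u = (fun y => sqn y * lapl u y -
    (euler (euler u) y + (N%:R - 2) * euler u y)).
  by apply/funext => y; rewrite sqn_lapl//; ring.
have er : euler (rot i j u) = rot i j (euler u) by apply/funext => y; exact: euler_rot.
have -> : sphlap (rot i j u) x = sqn x * lapl (rot i j u) x -
    (euler (euler (rot i j u)) x + (N%:R - 2) * euler (rot i j u) x).
  by rewrite sqn_lapl//; ring.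
rewrite lapl_rot// er euler_rot// -rot_sqnM//.
have s1 : smooth (fun y => sqn y * lapl u y) by apply: smoothM => //; exact: smooth_sqn.
have s2 : smooth (fun y => (N%:R - 2) * euler u y) by apply: smoothM => //; exact: smooth_cst.
rewrite /rot !(@pdB (fun y => sqn y * lapl u y) (fun y => euler (euler u) y + (N%:R - 2) * euler u y))//;
  try by apply: smoothD.
by rewrite !(@pdD (euler (euler u)) (fun y => (N%:R - 2) * euler u y))// !pdZ//; ring.
Qed.

(** This is Lagrange's identity for the position and the gradient. *)
Lemma sqn_gradsq u x :
  sqn x * gradsq u x = euler u x ^+ 2 + 2^-1 * \sum_i \sum_j rot i j u x ^+ 2.
Proof.
rewrite (wedge_sqr (fun k => x ord0 k) (fun k => pd k u x)).
have -> : sqn x = dot (fun k => x ord0 k) (fun k => x ord0 k).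
  by apply: eq_bigr => k _; rewrite expr2.
have -> : gradsq u x = dot (fun k => pd k u x) (fun k => pd k u x).
  by apply: eq_bigr => k _; rewrite expr2.
rewrite -[euler u x]/(dot (fun k => x ord0 k) (fun k => pd k u x)).
by field.
Qed.

(** This is the pointwise part of Bochner's argument on the sphere. Once both
    sides are expanded in terms of the gradient and of the Hessian, the gradient
    cancels, and the claim becomes that the tangential Hessian satisfies the
    Cauchy-Schwarz inequality of [compression_trace]; the constant is [N - 1]
    because it acts on a space of dimension [N - 1]. The term in [N - 2] is the
    Ricci curvature. *)
Lemma sum_rot_rot u x : smooth u -> (1 < N)%N ->
  sphlap u x ^+ 2 / (N%:R - 1) + (N%:R - 2) * (2^-1 * \sum_i \sum_j rot i j u x ^+ 2)
  <= 4^-1 * \sum_k \sum_l \sum_i \sum_j rot i j (rot k l u) x ^+ 2.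
Proof.
move=> su N1.
have N10 : 0 < N%:R - 1 :> R by rewrite subr_gt0 ltr1n.
pose X k := x ord0 k.
pose p k := pd k u x; pose h k l := pd k (pd l u) x.
have hC k l : h k l = h l k by exact: pdC.
pose z l := \sum_k X k * h k l.
have := compression_trace N1 hC (fun l => erefl (z l)).
pose D k l m := pd m (rot k l u) x.
have DE k l m : D k l m = ((m == k)%:R * p l - (m == l)%:R * p k)
   + (X k * h m l - X l * h m k).
  by rewrite /D pd_rot// -!/(p _) -!/(h _ _) -!/(X _); ring.
have xD k l : dot X (D k l) = X k * (p l + z l) - X l * (p k + z k).
  rewrite /dot; under eq_bigr do rewrite DE.
  transitivity (\sum_m ((m == k)%:R * (X m * p l) - (m == l)%:R * (X m * p k)) +
    (X k * (\sum_m X m * h m l) - X l * (\sum_m X m * h m k))).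
    rewrite 2!big_distrr -sumrB -big_split/=; apply: eq_bigr => m _; ring.
  rewrite sumrB (sum_deltar (fun m => X m * p l)) (sum_deltar (fun m => X m * p k)).
  rewrite -/(z l) -/(z k); ring.
have -> : \sum_k \sum_l \sum_i \sum_j rot i j (rot k l u) x ^+ 2 =
   2 * (dot X X * (\sum_m \sum_k \sum_l D k l m ^+ 2) - \sum_k \sum_l dot X (D k l) ^+ 2).
  transitivity (\sum_k \sum_l 2 * (dot X X * dot (D k l) (D k l) - dot X (D k l) ^+ 2)).
    apply: eq_bigr => k _. apply: eq_bigr => l _. by rewrite -wedge_sqr.
  under eq_bigr do rewrite -big_distrr/= sumrB -big_distrr/=.
  rewrite -big_distrr/= sumrB -big_distrr/=; congr (2 * (_ * _ - _)).
  rewrite [RHS]exchange_big; apply: eq_bigr => k _.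
  rewrite [RHS]exchange_big; apply: eq_bigr => l _.
  by apply: eq_bigr => m _; rewrite expr2.
have -> : \sum_k \sum_l dot X (D k l) ^+ 2 = 2 * (dot X X * (dot p p + 2 * dot p z + dot z z)
    - (dot X p + dot X z) ^+ 2).
  under eq_bigr do under eq_bigr do rewrite xD.
  rewrite (wedge_sqr X (fun k => p k + z k)); congr (2 * (_ * _ - _ ^+ 2)).
    rewrite /dot mulr_sumr -!big_split/=; apply: eq_bigr => k _; ring.
  rewrite /dot -!big_split/=; apply: eq_bigr => k _; ring.
have -> : \sum_m \sum_k \sum_l D k l m ^+ 2 =
    2 * (N%:R * dot p p - dot p p) + 4 * (dot p z - (\sum_k h k k) * dot X p)
    + 2 * (dot X X * (\sum_k \sum_l h k l ^+ 2) - dot z z).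
  transitivity (\sum_m (2 * (1 * dot p p - p m * p m)
     + 4 * (X m * dot p (h m) - h m m * dot X p)
     + 2 * (dot X X * dot (h m) (h m) - z m * z m))).
    apply: eq_bigr => m _.
    pose e k : R := (m == k)%:R.
    have de a : dot e a = a m by exact: sum_deltal.
    have zE : dot X (h m) = z m.
      by apply: eq_bigr => k _; rewrite hC.
    transitivity (\sum_k \sum_l ((e k * p l - e l * p k) * (e k * p l - e l * p k))
      + 2 * (\sum_k \sum_l ((e k * p l - e l * p k) * (X k * h m l - X l * h m k)))
      + \sum_k \sum_l ((X k * h m l - X l * h m k) * (X k * h m l - X l * h m k))).
      rewrite mulr_sumr -!big_split/=; apply: eq_bigr => k _.
      rewrite mulr_sumr -!big_split/=; apply: eq_bigr => l _.
      rewrite DE /e; ring.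
    rewrite !wedge_dot !de (dotC p e) de (dotC (h m) X) zE (dotC p X) /e eqxx /=; ring.
  rewrite !big_split/= -!mulr_sumr; congr (_ * _ + _ * _ + _ * _).
  - by rewrite sumrB -mulr_suml sumr_const card_ord.
  - rewrite sumrB -mulr_suml; congr (_ - _).
    rewrite /dot; under eq_bigr do rewrite big_distrr/=.
    rewrite exchange_big; apply: eq_bigr => l _; rewrite /z big_distrr/=.
    by apply: eq_bigr => m _; ring.
  - by rewrite sumrB -mulr_sumr.
have -> : \sum_i \sum_j rot i j u x ^+ 2 = 2 * (dot X X * dot p p - dot X p ^+ 2).
  exact: wedge_sqr.
have -> : sphlap u x = dot X X * (\sum_k h k k) - dot X z - (N%:R - 1) * dot X p.
  rewrite sphlapE//; congr (_ * _ - _ - _).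
  rewrite /dot exchange_big; apply: eq_bigr => l _; rewrite /z big_distrr/=.
  by apply: eq_bigr => k _; rewrite -/(h k l) -/(X k) -/(X l); ring.
move: (dot X X) (dot X z) (dot X p) (dot p p) (dot p z) (dot z z) (\sum_k h k k)
  (\sum_k \sum_l h k l ^+ 2) => a q al P be Z t F H.
rewrite -subr_ge0.
set n1 := N%:R - 1 in N10 H *.
have -> : N%:R = n1 + 1 :> R by rewrite /n1; ring.
have n10 : n1 != 0 by rewrite gt_eqF.
set W := (X in 0 <= X).
suff -> : W = (n1 * (a ^+ 2 * F - 2 * a * Z + q ^+ 2) - (a * t - q) ^+ 2) / n1.
  apply: divr_ge0; last exact: ltW.
  by rewrite subr_ge0.
by rewrite /W; field.
Qed.

End operators.

(** * Radially weighted integrals *)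

Section test_functions.
Context {R : realType} {N : nat}.
Local Notation V := 'rV[R]_N.
Implicit Types (f g u : V -> R) (x : V) (i j k l : 'I_N) (t : R) (Phi Psi : R -> R).

(** Test functions are handled through a bound [t1] on [|x| ^ 2] instead of a
    compact support: membership is then immediate for all the functions built from
    a given one. *)
Definition test_below (t1 : R) f := smooth f /\ forall x, t1 < sqn x -> f x = 0.

Variable t1 : R.
Local Notation test := (test_below t1).

Lemma near_sqn_gt t x : t < sqn x -> \forall y \near x, t < sqn y.
Proof.
move=> tx; have : sqn y @[y --> x] --> sqn x by exact: smooth_continuous smooth_sqn x.
by move/(cvgr_gt (sqn x)); exact.
Qed.

Lemma testM f g : smooth f -> test g -> test (fun x => f x * g x).
Proof.
move=> sf [sg g0]; split; first exact: smoothM.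
by move=> x /g0 ->; rewrite mulr0.
Qed.

Lemma testD f g : test f -> test g -> test (fun x => f x + g x).
Proof.
move=> [sf f0] [sg g0]; split; first exact: smoothD.
by move=> x xt; rewrite f0// g0// addr0.
Qed.

Lemma testZ c f : test f -> test (fun x => c * f x).
Proof. by apply: testM; exact: smooth_cst. Qed.

Lemma test_sum (I : Type) (s : seq I) (F : I -> V -> R) :
  (forall k : I, test (F k)) -> test (fun y => \sum_(k <- s) F k y).
Proof.
move=> tF; split; first by apply: smooth_sum => k; have [] := tF k.
by move=> x xt; apply: big1 => k _; have [_ ->] := tF k.
Qed.

Lemma test_pd i f : test f -> test (pd i f).
Proof.
move=> [sf f0]; split; first exact: smooth_pd.
move=> x xt; rewrite -(pd_cst i 0 x) pdE /partial; apply: near_eq_derive.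
by apply: filterS (near_sqn_gt xt) => y /f0.
Qed.

Lemma test_sqr f : test f -> test (fun x => f x ^+ 2).
Proof. by move=> tf; under [X in test X]eq_fun do rewrite expr2; apply: testM; first case: tf. Qed.

Lemma test_euler f : test f -> test (euler f).
Proof. by move=> tf; apply: test_sum => k; apply: testM; [exact: smooth_coord|exact: test_pd]. Qed.

Lemma test_rot i j f : test f -> test (rot i j f).
Proof.
move=> tf; split; first by apply: smooth_rot; case: tf.
by move=> x xt; rewrite /rot; have [_ ->//] := test_pd i tf; have [_ ->//] := test_pd j tf;
  rewrite !mulr0 subrr.
Qed.

Lemma test_sphlap f : test f -> test (sphlap f).
Proof.
move=> tf; apply: testZ; apply: test_sum => i; apply: test_sum => j.
by do 2 apply: test_rot.
Qed.

Lemma test_lapl f : test f -> test (lapl f).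
Proof. by move=> tf; apply: test_sum => i; do 2 apply: test_pd. Qed.

Lemma test_gradsq f : test f -> test (gradsq f).
Proof. by move=> tf; apply: test_sum => i; apply/test_sqr/test_pd. Qed.

Lemma eulerM f g x : smooth f -> smooth g ->
  euler (fun y => f y * g y) x = euler f x * g x + f x * euler g x.
Proof.
move=> sf sg; rewrite /euler mulr_suml mulr_sumr -big_split/=.
by apply: eq_bigr => k _; rewrite pdM//; ring.
Qed.

Lemma euler_sqr f x : smooth f -> euler (fun y => f y ^+ 2) x = 2 * (f x * euler f x).
Proof.
by move=> sf; under [X in euler X]eq_fun do rewrite expr2; rewrite eulerM//; ring.
Qed.

Lemma rotM i j f g x : smooth f -> smooth g ->
  rot i j (fun y => f y * g y) x = rot i j f x * g x + f x * rot i j g x.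
Proof. by move=> sf sg; rewrite /rot !pdM//; ring. Qed.

Lemma euler_sqr_le f x : euler f x ^+ 2 <= sqn x * gradsq f x.
Proof.
rewrite sqn_gradsq lerDl mulr_ge0// ?invr_ge0//.
by apply: sumr_ge0 => i _; apply: sumr_ge0 => j _; exact: sqr_ge0.
Qed.

Lemma rot_sqr_le i j f x : rot i j f x ^+ 2 <= 2 * (sqn x * gradsq f x).
Proof.
rewrite sqn_gradsq mulrDr [2 * (2^-1 * _)]mulrA divff// mul1r.
have r0 k l : 0 <= rot k l f x ^+ 2 by exact: sqr_ge0.
rewrite (le_trans _ (_ : \sum_k \sum_l rot k l f x ^+ 2 <= _))//; last first.
  by rewrite lerDr mulr_ge0// sqr_ge0.
rewrite (bigD1 i)//= (bigD1 j)//= -addrA lerDl addr_ge0//; first exact: sumr_ge0.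
by apply: sumr_ge0 => k _; exact: sumr_ge0.
Qed.

Definition cont_below (T : R) Phi := forall t, 0 <= t < T -> {for t, continuous Phi}.

(** The weights of interest are singular on a sphere [|x| ^ 2 = T]; a weight
    need be regular only on the part of the half-line where test functions live. *)
Definition C1_below (T : R) Phi dPhi :=
  (forall t, 0 <= t < T -> is_derive t 1 Phi (dPhi t)) /\ cont_below T dPhi.

Lemma C1_cont_below T Phi dPhi : C1_below T Phi dPhi -> cont_below T Phi.
Proof.
move=> [d _] t tT; apply: differentiable_continuous; apply/derivable1_diffP.
by case: (d t tT).
Qed.

Variable T : R.
Hypothesis t1T : t1 < T.

Lemma test_bounded_supp f : (forall x, t1 < sqn x -> f x = 0) -> bounded_supp f.
Proof.
move=> f0; exists (`|t1| + 1) => x i xi; apply: f0.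
have t0 : 0 <= `|t1| by exact: normr_ge0.
have : `|x ord0 i| ^+ 2 <= sqn x.
  rewrite real_normK ?num_real// /sqn (bigD1 i)//= lerDl.
  by apply: sumr_ge0 => k _; exact: sqr_ge0.
apply: lt_le_trans; rewrite (le_lt_trans (ler_norm _))//.
by rewrite expr2; nra.
Qed.

Lemma radial_Cc Phi f : cont_below T Phi -> continuous f ->
  (forall x, t1 < sqn x -> f x = 0) -> Cc (fun x => Phi (sqn x) * f x).
Proof.
move=> cP cf f0; split; last first.
  by apply: test_bounded_supp => x /f0 ->; rewrite mulr0.
move=> x; have [xT|Tx] := ltP (sqn x) T.
  apply: continuousM; last exact: cf.
  apply: (@continuous_comp _ _ _ (@sqn R N) Phi); first exact: smooth_continuous smooth_sqn x.
  by apply: cP; rewrite sqn_ge0.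
have tx := lt_le_trans t1T Tx.
have near0 : \forall y \near x, Phi (sqn y) * f y = Phi (sqn x) * f x.
  by apply: filterS (near_sqn_gt tx) => y ty; rewrite !f0// !mulr0.
exact: cvg_near_cst near0.
Qed.

Lemma radial_test_Cc Phi f : cont_below T Phi -> test f -> Cc (fun x => Phi (sqn x) * f x).
Proof. by move=> cP [sf f0]; apply: radial_Cc => //; exact: smooth_continuous. Qed.

(** Every integral of the proof has this form, so that linearity, monotonicity
    and integration by parts are each needed only once. *)
Definition J Phi f : R := \int[lebesgue_rV N]_x (Phi (sqn x) * f x).

Lemma J_integrable Phi f : cont_below T Phi -> test f ->
  (lebesgue_rV N).-integrable setT (EFin \o (fun x => Phi (sqn x) * f x)).
Proof. by move=> cP tf; apply/Cc_integrable/radial_test_Cc. Qed.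

Lemma eq_J Phi Phi' f f' : (forall x, Phi (sqn x) * f x = Phi' (sqn x) * f' x) ->
  J Phi f = J Phi' f'.
Proof. by move=> E; apply: eq_Rintegral => x _; exact: E. Qed.

Lemma JD Phi f g : cont_below T Phi -> test f -> test g ->
  J Phi (fun x => f x + g x) = J Phi f + J Phi g.
Proof.
move=> cP tf tg; rewrite /J -RintegralD//; try exact: J_integrable.
by apply: eq_Rintegral => x _; rewrite mulrDr.
Qed.

Lemma JZ c Phi f : cont_below T Phi -> test f ->
  J Phi (fun x => c * f x) = c * J Phi f.
Proof.
move=> cP tf; rewrite /J -RintegralZl//; try exact: J_integrable.
by apply: eq_Rintegral => x _; rewrite mulrCA.
Qed.

Lemma JlD Phi Psi f : cont_below T Phi -> cont_below T Psi -> test f ->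
  J (fun t => Phi t + Psi t) f = J Phi f + J Psi f.
Proof.
move=> cP cP' tf; rewrite /J -RintegralD//; try exact: J_integrable.
by apply: eq_Rintegral => x _; rewrite mulrDl.
Qed.

Lemma JlZ c Phi f : cont_below T Phi -> test f ->
  J (fun t => c * Phi t) f = c * J Phi f.
Proof. by move=> cP tf; rewrite -JZ//; apply: eq_J => x; rewrite mulrCA mulrA. Qed.

Lemma J_sum (I : Type) (s : seq I) Phi (F : I -> V -> R) :
  cont_below T Phi -> (forall k : I, test (F k)) ->
  J Phi (fun x => \sum_(k <- s) F k x) = \sum_(k <- s) J Phi (F k).
Proof.
move=> cP tF; elim: s => [|k s IH].
  rewrite big_nil -[RHS](mul0r (J Phi (fun=> 0))) -JZ//.
    by apply: eq_J => x; rewrite big_nil !mulr0.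
  by split => //; exact: smooth_cst.
by under [X in J _ X]eq_fun do rewrite big_cons; rewrite JD ?big_cons ?IH//; exact: test_sum.
Qed.

Lemma le_J Phi Psi f g : cont_below T Phi -> cont_below T Psi -> test f -> test g ->
  (forall x, sqn x <= t1 -> Phi (sqn x) * f x <= Psi (sqn x) * g x) ->
  J Phi f <= J Psi g.
Proof.
move=> cP cP' tf tg le; apply: le_Rintegral => //; try exact: J_integrable.
move=> x _; have [xt|tx] := leP (sqn x) t1; first exact: le.
by case: tf => _ ->//; case: tg => _ ->//; rewrite !mulr0.
Qed.

Lemma J_ge0 Phi f : (forall x, sqn x <= t1 -> 0 <= Phi (sqn x)) -> (forall x, 0 <= f x) ->
  (forall x, t1 < sqn x -> f x = 0) -> 0 <= J Phi f.
Proof.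
move=> P0 f0 ft; apply: Rintegral_ge0 => x _.
have [xt|/ft ->] := leP (sqn x) t1; last by rewrite mulr0.
by rewrite mulr_ge0// P0.
Qed.

(** Beyond [t1] the product vanishes near each point, whatever the weight does
    there. *)
Lemma radial_pd Phi dPhi f i x : C1_below T Phi dPhi -> test f ->
  derivable (fun x => Phi (sqn x) * f x) x (delta_mx ord0 i) /\
  partial i (fun x => Phi (sqn x) * f x) x =
  dPhi (sqn x) * (2 * x ord0 i * f x) + Phi (sqn x) * pd i f x.
Proof.
move=> [dP _] [sf f0]; have [xT|Tx] := ltP (sqn x) T.
  have [d1 d2] := partial_radial i (dP (sqn x) (introT andP (conj (sqn_ge0 x) xT))).
  have df := smooth_differentiable x sf.
  split; last by rewrite partialM// d2 pdE; ring.
  exact/diff_derivable/differentiableM.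
have tx := lt_le_trans t1T Tx.
have near0 : \forall y \near x, Phi (sqn y) * f y = 0.
  by apply: filterS (near_sqn_gt tx) => y /f0 ->; rewrite mulr0.
split.
  by apply: (near_eq_derivable _ (derivable_cst (0 : R) x _)); apply: filterS near0 => y ->.
rewrite /partial (near_eq_derive _ near0) derive_cst f0// !mulr0 add0r.
by case: (test_pd i (conj sf f0)) => _ ->//; rewrite mulr0.
Qed.

Lemma J_ibp Phi dPhi f i : C1_below T Phi dPhi -> test f ->
  J dPhi (fun x => 2 * x ord0 i * f x) + J Phi (pd i f) = 0.
Proof.
move=> CP tf.
have cP := C1_cont_below CP; have [_ cdP] := CP.
have tf2 : test (fun x => 2 * x ord0 i * f x).
  by apply: testM => //; apply: smoothM; [exact: smooth_cst|exact: smooth_coord].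
have tpf := test_pd i tf.
rewrite /J -RintegralD//; try exact: J_integrable.
have E : partial i (fun x => Phi (sqn x) * f x) = (fun x =>
  dPhi (sqn x) * (2 * x ord0 i * f x) + Phi (sqn x) * pd i f x).
  by apply/funext => x; have [] := radial_pd i x CP tf.
transitivity (\int[lebesgue_rV N]_x partial i (fun x => Phi (sqn x) * f x) x).
  by rewrite E.
rewrite /Rintegral (@integral_partial R N)//.
- by move=> x; have [] := radial_pd i x CP tf.
- exact: radial_test_Cc.
- rewrite E; split.
    move=> x; have [c1 _] := radial_test_Cc cdP tf2; have [c2 _] := radial_test_Cc cP tpf.
    exact: cvgD (c1 x) (c2 x).
  apply: test_bounded_supp => x tx; case: tf2 => _ ->//; case: tpf => _ ->//.
  by rewrite !mulr0 addr0.
Qed.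

(** This is the divergence theorem for the field [Phi (|x| ^ 2) f x]. *)
Lemma J_euler Phi dPhi f : C1_below T Phi dPhi -> test f ->
  J Phi (euler f) = - J (fun t => N%:R * Phi t + 2 * t * dPhi t) f.
Proof.
move=> CP tf.
have cP := C1_cont_below CP; have [_ cdP] := CP.
have txf i : test (fun x => x ord0 i * f x) by apply: testM => //; exact: smooth_coord.
have tx2f i : test (fun x => 2 * x ord0 i * (x ord0 i * f x)).
  by apply: testM => //; apply: smoothM; [exact: smooth_cst|exact: smooth_coord].
have : \sum_i (J dPhi (fun x => 2 * x ord0 i * (x ord0 i * f x))
   + J Phi (pd i (fun x => x ord0 i * f x))) = 0.
  by apply: big1 => i _; exact: J_ibp.
rewrite big_split/= -!J_sum//; last by move=> i; exact: test_pd.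
have -> : J Phi (fun x => \sum_i pd i (fun x => x ord0 i * f x) x) =
    J Phi (fun x => N%:R * f x + euler f x).
  apply: eq_J => x; congr (_ * _).
  under eq_bigr do rewrite (pd_coordM _ _ _ tf.1) eqxx mul1r.
  by rewrite big_split/= sumr_const card_ord -[f x *+ N]mulr_natl.
have te := test_euler tf.
rewrite JD//; last exact: testZ.
have cP' : cont_below T (fun t => N%:R * Phi t + 2 * t * dPhi t).
  move=> t tT; apply: cvgD; apply: cvgM.
  - exact: cvg_cst.
  - exact: cP.
  - by apply: cvgM; [exact: cvg_cst|exact: cvg_id].
  - exact: cdP.
have -> : J (fun t => N%:R * Phi t + 2 * t * dPhi t) f =
   J dPhi (fun x => \sum_i 2 * x ord0 i * (x ord0 i * f x)) + J Phi (fun x => N%:R * f x).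
  rewrite /J -RintegralD//; last 2 first.
  - by apply: J_integrable => //; exact: test_sum.
  - by apply: J_integrable => //; exact: testZ.
  apply: eq_Rintegral => x _.
  have -> : \sum_i 2 * x ord0 i * (x ord0 i * f x) = 2 * sqn x * f x.
    by rewrite /sqn mulr_sumr mulr_suml; apply: eq_bigr => i _; ring.
  by ring.
by rewrite addrA => /eqP; rewrite addrC addr_eq0 => /eqP.
Qed.

(** A rotation field is free of divergence and tangent to the spheres, on
    which the weight is constant. *)
Lemma J_rot Phi dPhi f i j : C1_below T Phi dPhi -> test f -> J Phi (rot i j f) = 0.
Proof.
move=> CP tf.
have cP := C1_cont_below CP; have [_ cdP] := CP.
have txf k : test (fun x => x ord0 k * f x) by apply: testM => //; exact: smooth_coord.
have := J_ibp j CP (txf i); have := J_ibp i CP (txf j).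
have -> : J dPhi (fun x => 2 * x ord0 i * (x ord0 j * f x)) =
          J dPhi (fun x => 2 * x ord0 j * (x ord0 i * f x)).
  by apply: eq_J => x; ring.
set a := J dPhi _ => E1 E2.
have E : J Phi (rot i j f) = J Phi (pd j (fun x => x ord0 i * f x)) +
   -1 * J Phi (pd i (fun x => x ord0 j * f x)).
  have t1' := test_pd j (txf i); have t2' := test_pd i (txf j).
  rewrite -JZ// -JD//; last exact: testZ.
  apply: eq_J => x; congr (_ * _); have [sf _] := tf.
  by rewrite !pd_coordM// /rot (eq_sym j i); ring.
by rewrite E; lra.
Qed.

End test_functions.

(** * Hardy inequalities with regularized weights *)

Section rellich.
Context {R : realType} {N : nat}.
Local Notation V := 'rV[R]_N.
Implicit Types (f g u : V -> R) (x : V) (i j k l : 'I_N) (t : R) (Phi Psi : R -> R).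

Lemma continuous_derive (f : R -> R) t (a : R) : is_derive t 1 f a -> {for t, continuous f}.
Proof. by case=> d _; apply: differentiable_continuous; exact/derivable1_diffP. Qed.

Lemma C1_cst T c : C1_below T (fun=> c : R) (fun=> 0).
Proof. by split => t tT; [exact: is_derive_cst|exact: cvg_cst]. Qed.

Lemma C1D T F dF G dG : C1_below T F dF -> C1_below T G dG ->
  C1_below T (fun t : R => F t + G t : R) (fun t => dF t + dG t).
Proof.
move=> [d c] [d' c']; split => t tT.
  by have := d t tT; have := d' t tT => ? ?; exact: is_deriveD.
by apply: cvgD; [exact: c|exact: c'].
Qed.

Lemma C1M T F dF G dG : C1_below T F dF -> C1_below T G dG ->
  C1_below T (fun t : R => F t * G t : R) (fun t => dF t * G t + F t * dG t).
Proof.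
move=> CF CG; have cF := C1_cont_below CF; have cG := C1_cont_below CG.
case: CF CG => [d c] [d' c']; split => t tT.
  have := d t tT; have := d' t tT => dGt dFt.
  apply: is_derive_eq; rewrite /GRing.scale/=; ring.
by apply: cvgD; apply: cvgM; [exact: c|exact: cG|exact: cF|exact: c'].
Qed.

Variables (t1 T : R).
Hypothesis t1T : t1 < T.
Local Notation test := (test_below t1).

Lemma le_J2 Phi Phi' Psi f f' g : cont_below T Phi -> cont_below T Phi' ->
  cont_below T Psi -> test f -> test f' -> test g ->
  (forall x, sqn x <= t1 ->
     Phi (sqn x) * f x + Phi' (sqn x) * f' x <= Psi (sqn x) * g x) ->
  J Phi f + J Phi' f' <= J Psi g.
Proof.
move=> cP cP' cQ tf tf' tg le; rewrite /J -RintegralD//;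
  try exact: (J_integrable t1T).
have i1 := J_integrable t1T cP tf; have i2 := J_integrable t1T cP' tf'.
have i3 := J_integrable t1T cQ tg.
apply: le_Rintegral => //; first by have := integrableD measurableT i1 i2.
move=> x _; have [xt|tx] := leP (sqn x) t1; first exact: le.
by case: tf => _ ->//; case: tf' => _ ->//; case: tg => _ ->//; rewrite !mulr0 addr0.
Qed.

Variable e : R.
Hypothesis e0 : 0 < e.

(** Integrations by parts against negative powers of [|x|] are not legitimate at
    the origin. The weights [|x|^-2] and [|x|^-4] are therefore replaced by
    [(|x|^2 + e)^-1] and its square. *)
Definition reg1 t : R := (t + e)^-1.

Lemma te_gt0 t : 0 <= t -> 0 < t + e.
Proof. by move=> t0; rewrite ltr_pwDr. Qed.

Lemma reg1_gt0 t : 0 <= t -> 0 < reg1 t.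
Proof. by move=> t0; rewrite invr_gt0 te_gt0. Qed.

Lemma reg1E t : 0 <= t -> (t + e) * reg1 t = 1.
Proof. by move=> t0; rewrite divff// gt_eqF// te_gt0. Qed.

Lemma reg1_le1 t : 0 <= t -> 0 <= t * reg1 t <= 1.
Proof.
move=> t0; have w0 := ltW (reg1_gt0 t0); apply/andP; split; first exact: mulr_ge0.
by rewrite -[X in _ <= X](reg1E t0) mulrDl lerDl mulr_ge0// ltW.
Qed.

Lemma C1_reg1 S : C1_below S reg1 (fun t => - (reg1 t ^+ 2)).
Proof.
have d t : 0 <= t < S -> is_derive t 1 reg1 (- (reg1 t ^+ 2)).
  move=> /andP[t0 _].
  have dte : is_derive t 1 (fun t : R => t + e) (1 + 0).
    exact: (@is_deriveD _ _ _ id (cst e)).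
  have te0 : t + e != 0 by rewrite gt_eqF// te_gt0.
  have -> : - (reg1 t ^+ 2) = - (t + e) ^- 2 *: (1 + 0 : R^o).
    by rewrite addr0 [_ *: _]mulr1 /reg1 exprVn.
  exact: (@is_deriveV _ (fun t : R => t + e) _ _ _ te0 dte).
split=> // t tS.
apply: cvgN; apply: cvgM; exact: (continuous_derive (d t tS)).
Qed.

Lemma C1_reg2 S : C1_below S (fun t => reg1 t * reg1 t) (fun t => - 2 * reg1 t ^+ 3).
Proof.
have <- : (fun t => - (reg1 t ^+ 2) * reg1 t + reg1 t * - (reg1 t ^+ 2)) =
          (fun t => - 2 * reg1 t ^+ 3) by apply/funext => t; ring.
exact: C1M (C1_reg1 S) (C1_reg1 S).
Qed.

Lemma cont_reg1X S n c : cont_below S (fun t => c * reg1 t ^+ n).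
Proof.
move=> t tS; apply: cvgM; first exact: cvg_cst.
have cw := C1_cont_below (C1_reg1 S) tS.
exact: (continuous_comp cw (@exprn_continuous R n _)).
Qed.

(** The hypothesis is the assertion that the divergence of [Phi (|x| ^ 2) x]
    is at least [Phi (|x| ^ 2)]; the inequality then follows from the divergence
    theorem for [f ^ 2] and from Cauchy-Schwarz. *)
Lemma hardy_weight Phi dPhi f : C1_below T Phi dPhi -> test f ->
  (forall t, 0 <= t <= t1 -> 0 <= Phi t <= N%:R * Phi t + 2 * t * dPhi t) ->
  J Phi (fun x => f x ^+ 2) <= 4 * J Phi (fun x => euler f x ^+ 2).
Proof.
move=> CP tf h; have cP := C1_cont_below CP; have [_ cdP] := CP.
have sf : smooth f by case: tf.
have tf2 := test_sqr tf; have te2 := test_sqr (test_euler tf).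
have := J_euler t1T CP tf2; set K := (fun t : R => _ + _) => EK.
have cK : cont_below T K.
  move=> t tT; apply: cvgD; apply: cvgM.
  - exact: cvg_cst.
  - exact: cP.
  - by apply: cvgM; [exact: cvg_cst|exact: cvg_id].
  - exact: cdP.
have h1 : J Phi (fun x => f x ^+ 2) <= J K (fun x => f x ^+ 2).
  apply: (le_J t1T) => // x xt; rewrite ler_wpM2r ?sqr_ge0//.
  by have /andP[] := h (sqn x) (introT andP (conj (sqn_ge0 x) xt)).
have h2 : -1 * J Phi (euler (fun x => f x ^+ 2)) <=
   J Phi (fun x => 2^-1 * f x ^+ 2 + 2 * euler f x ^+ 2).
  rewrite -(JZ t1T)//; last exact: test_euler.
  apply: (le_J t1T) => //.
  - exact/testZ/test_euler.
  - by apply: testD; exact: testZ.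
  move=> x xt; apply: ler_wpM2l.
    by have /andP[] := h (sqn x) (introT andP (conj (sqn_ge0 x) xt)).
  by rewrite euler_sqr//; have := sqr_ge0 (f x + 2 * euler f x); nra.
rewrite (JD t1T) ?(JZ t1T) in h2 => //; try exact: testZ.
lra.
Qed.

Hypothesis hN : (5 <= N)%N.

Let N5 : 5 <= N%:R :> R.
Proof. by rewrite ler_nat. Qed.

Lemma hardy_reg1 f : test f ->
  J reg1 (fun x => f x ^+ 2) <= 4 * J (fun=> 1) (gradsq f).
Proof.
move=> tf; have C1 := C1_reg1 T; have cw := C1_cont_below C1.
apply: (le_trans (hardy_weight C1 tf _)).
  move=> t /andP[t0 _]; rewrite ltW ?reg1_gt0//=.
  have /andP[tw0 tw1] := reg1_le1 t0; have w0 := reg1_gt0 t0; have n5 := N5.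
  rewrite -subr_ge0 (_ : _ - _ = (N%:R - 1 - 2 * (t * reg1 t)) * reg1 t); last by ring.
  by apply: mulr_ge0; [lra|exact: ltW].
rewrite ler_pM2l//; apply: (le_J t1T) => //.
- exact: C1_cont_below (C1_cst T 1).
- exact/test_sqr/test_euler.
- exact: test_gradsq.
move=> x _; have x0 := sqn_ge0 x.
have := euler_sqr_le f x; have /andP[w0 reg1'] := reg1_le1 x0.
have g0 : 0 <= gradsq f x by apply: sumr_ge0 => k _; exact: sqr_ge0.
move=> h; apply: (@le_trans _ _ (reg1 (sqn x) * (sqn x * gradsq f x))).
  by rewrite ler_wpM2l// ltW// reg1_gt0.
by rewrite mulrA ler_wpM2r// mulrC.
Qed.

Definition reg2 t := reg1 t * reg1 t.

(** The bound that [hardy_reg2] gives for the integral of [reg2 f ^ 2]; it does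
    not depend on [e]. *)
Definition hess_energy f : R := 16 * \sum_k J (fun=> 1) (gradsq (pd k f)).

(** Two Hardy inequalities in a row, with the weights [reg2] and [reg1]. In the
    first one the divergence of [reg2 (|x| ^ 2) x] may be as small as
    [(N - 4) reg2], and it is at least [reg2] because [5 <= N]. *)
Lemma hardy_reg2 f : test f -> J reg2 (fun x => f x ^+ 2) <= hess_energy f.
Proof.
move=> tf; have C1 := C1_reg2 T; have cQ := C1_cont_below C1.
have cw := C1_cont_below (C1_reg1 T).
apply: (le_trans (hardy_weight C1 tf _)).
  move=> t /andP[t0 _]; have w0 := reg1_gt0 t0.
  apply/andP; split; first by rewrite mulr_ge0// ltW.
  have /andP[tw0 tw1] := reg1_le1 t0; have n5 := N5.
  rewrite -subr_ge0 (_ : _ - _ = (N%:R - 1 - 4 * (t * reg1 t)) * (reg1 t * reg1 t)); last by ring.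
  by apply: mulr_ge0; [lra|rewrite mulr_ge0// ltW].
rewrite /hess_energy [16](_ : _ = 4 * 4) -?mulrA ?ler_pM2l//; last by ring.
apply: (@le_trans _ _ (J reg1 (gradsq f))).
  apply: (le_J t1T) => //.
  - exact/test_sqr/test_euler.
  - exact: test_gradsq.
  move=> x _; have x0 := sqn_ge0 x.
  have := euler_sqr_le f x; have /andP[w0 reg1'] := reg1_le1 x0.
  have g0 : 0 <= gradsq f x by apply: sumr_ge0 => k _; exact: sqr_ge0.
  move=> h; apply: (@le_trans _ _ (reg2 (sqn x) * (sqn x * gradsq f x))).
    by rewrite ler_wpM2l// mulr_ge0// ltW// reg1_gt0.
  have -> : reg2 (sqn x) * (sqn x * gradsq f x) =
    (sqn x * reg1 (sqn x)) * (reg1 (sqn x) * gradsq f x) by rewrite /reg2; ring.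
  by rewrite ler_piMl// mulr_ge0// ltW// reg1_gt0.
rewrite (J_sum t1T)//; last by move=> k; exact/test_sqr/test_pd.
by rewrite mulr_sumr; apply: ler_sum => k _; exact/hardy_reg1/test_pd.
Qed.

(** Because of the regularization, the divergence of [reg2 (|x| ^ 2) x] is
    [(N - 4) reg2 + 4 defect] instead of [(N - 4) reg2]. *)
Definition defect t := e * reg1 t ^+ 3.

(** The defect is at most [e * reg2 / |x| ^ 2], and [f] vanishes at the origin:
    its contribution is therefore of order [e], by [hardy_reg2]. *)
Lemma J_defect_le f g (c : R) : test f -> test g -> 0 <= c ->
  (forall x, f x ^+ 2 <= c * (sqn x * gradsq g x)) ->
  J defect (fun x => f x ^+ 2) <= c * (\sum_k hess_energy (pd k g)) * e.
Proof.
move=> tf tg c0 fg.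
have cQ := C1_cont_below (C1_reg2 T).
have ce3 := @cont_reg1X T 3 e.
apply: (@le_trans _ _ (J (fun t => (c * e) * reg2 t) (gradsq g))).
  apply: (le_J t1T) => //.
  - by move=> t tT; apply: cvgM; [exact: cvg_cst|exact: cQ].
  - exact: test_sqr.
  - exact: test_gradsq.
  move=> x _; have x0 := sqn_ge0 x.
  have /andP[w0 reg1'] := reg1_le1 x0; have wp := reg1_gt0 x0.
  have g0 : 0 <= gradsq g x by apply: sumr_ge0 => k _; exact: sqr_ge0.
  apply: (@le_trans _ _ (defect (sqn x) * (c * (sqn x * gradsq g x)))).
    by rewrite ler_wpM2l// mulr_ge0 ?exprn_ge0// ltW.
  have -> : defect (sqn x) * (c * (sqn x * gradsq g x)) =
    (sqn x * reg1 (sqn x)) * (c * e * reg2 (sqn x) * gradsq g x) by rewrite /defect /reg2; ring.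
  by rewrite ler_piMl// !mulr_ge0// ltW.
rewrite (JlZ t1T)//; last exact: test_gradsq.
rewrite [leRHS]mulrAC ler_wpM2l//; first by rewrite mulr_ge0// ltW.
rewrite (J_sum t1T)//; last by move=> k; exact/test_sqr/test_pd.
by apply: ler_sum => k _; exact/hardy_reg2/test_pd.
Qed.

(** With [Psi = |x| phi' / phi] as a function of [s = |x| ^ 2], this is
    [|x| ^ 2 W] when [phi] solves the radial equation
    [phi'' + (N + 1) / |x| phi' + W phi = 0]. *)
Definition riccati (Psi dPsi : R -> R) s :=
  - (2 * s * dPsi s) - N%:R * Psi s - Psi s ^+ 2.

(** The left-hand side is what is left of the square of [E f - (2 + Psi) f],
    where [E] is the Euler field, once the cross term, which is [E (f ^ 2)] times
    a radial weight, has been integrated by parts. The shift by [2] is the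
    substitution [f = |x|^2 w], which moves the problem to dimension [N + 2] and
    turns the Hardy weight into the expression [riccati]; for an optimal weight,
    [Psi] is the logarithmic derivative [|x| phi' / phi] of a radial positive
    solution [phi] of the corresponding equation. The terms in [C] come from the
    regularization. *)
Lemma hardy_riccati (Psi dPsi : R -> R) (C : R) f : test f ->
  C1_below T (fun t => Psi (t + e)) (fun t => dPsi (t + e)) ->
  (forall t, 0 <= t <= t1 -> `|2 + Psi (t + e)| <= C /\ `|dPsi (t + e)| <= C) ->
  J (fun t => reg2 t * riccati Psi dPsi (t + e)) (fun x => f x ^+ 2)
    - (2 * (N%:R - 2) + 2 * C * e) * J reg2 (fun x => f x ^+ 2)
    - 4 * C * J defect (fun x => f x ^+ 2)
  <= J reg2 (fun x => euler f x ^+ 2).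
Proof.
move=> tf CPsi bnd; pose w := riccati Psi dPsi.
have sf : smooth f by case: tf.
have tf2 := test_sqr tf; have te2 := test_sqr (test_euler tf).
have CQ := C1_reg2 T; have cQ := C1_cont_below CQ.
have CG := C1D (C1_cst T 2) CPsi.
have CQG := C1M CQ CG; have cG := C1_cont_below CG; have cQG := C1_cont_below CQG.
have [_ cdQG] := CQG; have cPsi := C1_cont_below CPsi; have [_ cdPsi] := CPsi.
have ce3 := @cont_reg1X T 3 e.
set G := (fun t : R => 2 + Psi (t + e)) in CG CQG cG cQG cdQG *.
set dQG := (fun t : R => _ + _) in CQG cdQG.
have := J_euler t1T CQG tf2; set K := (fun t : R => _ + _) => EK.
have cid : cont_below T (fun t => t) by move=> t _; exact: cvg_id.
have cK : cont_below T K.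
  move=> t tT; apply: cvgD; apply: cvgM.
  - exact: cvg_cst.
  - exact: cQG.
  - by apply: cvgM; [exact: cvg_cst|exact: cvg_id].
  - exact: cdQG.
have cQG2 : cont_below T (fun t => - (reg2 t * G t ^+ 2)).
  move=> t tT; apply: cvgN; apply: cvgM; first exact: cQ.
  by under eq_fun do rewrite expr2; apply: cvgM; exact: cG.
have cwe : cont_below T (fun t => w (t + e)).
  move=> t tT; have p := cPsi t tT; have dp := cdPsi t tT.
  apply: cvgB; last by under eq_fun do rewrite expr2; apply: cvgM.
  apply: cvgB; last by apply: cvgM => //; exact: cvg_cst.
  apply: cvgN; apply: cvgM => //; apply: cvgM; first exact: cvg_cst.
  by apply: cvgD; [exact: cvg_id|exact: cvg_cst].
have cQw : cont_below T (fun t => reg2 t * w (t + e)).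
  by move=> t tT; apply: cvgM; [exact: cQ|exact: cwe].
have square : J (fun t => reg2 t * G t) (euler (fun x => f x ^+ 2)) +
    J (fun t => - (reg2 t * G t ^+ 2)) (fun x => f x ^+ 2) <= J reg2 (fun x => euler f x ^+ 2).
  apply: le_J2 => //; first exact: test_euler.
  move=> x _; rewrite euler_sqr//.
  have := sqr_ge0 (euler f x - G (sqn x) * f x).
  have : 0 <= reg2 (sqn x) by rewrite mulr_ge0// ltW// reg1_gt0// sqn_ge0.
  move: (reg2 _) (G _) (euler f x) (f x) => q a b c q0 h.
  rewrite -subr_ge0.
  have -> : q * b ^+ 2 - (q * a * (2 * (c * b)) + - (q * a ^+ 2) * c ^+ 2) =
    q * (b - a * c) ^+ 2 by ring.
  exact: mulr_ge0.
apply: le_trans square; rewrite EK.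
have -> : - J K (fun x => f x ^+ 2) = J (fun t => -1 * K t) (fun x => f x ^+ 2).
  by rewrite (JlZ t1T)// mulN1r.
have cK' : cont_below T (fun t => -1 * K t).
  by move=> t tT; apply: cvgM; [exact: cvg_cst|exact: cK].
rewrite -(JlD t1T)//.
pose c := 2 * (N%:R - 2) + 2 * C * e.
have c1 : cont_below T (fun t => - c * reg2 t).
  by move=> t tT; apply: cvgM; [exact: cvg_cst|exact: cQ].
have c2 : cont_below T (fun t => - (4 * C) * defect t).
  by move=> t tT; apply: cvgM; [exact: cvg_cst|exact: ce3].
have c12 : cont_below T (fun t => - c * reg2 t + - (4 * C) * defect t).
  by move=> t tT; apply: cvgD; [exact: c1|exact: c2].
have -> : J (fun t => reg2 t * riccati Psi dPsi (t + e)) (fun x => f x ^+ 2)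
    - c * J reg2 (fun x => f x ^+ 2) - 4 * C * J defect (fun x => f x ^+ 2) =
  J (fun t => reg2 t * w (t + e) + (- c * reg2 t + - (4 * C) * defect t)) (fun x => f x ^+ 2).
  rewrite (JlD t1T cQw c12 tf2) (JlD t1T c1 c2 tf2) (JlZ t1T _ cQ tf2) (JlZ t1T _ ce3 tf2).
  rewrite -/w; ring.
apply: (le_J t1T) => //.
- by move=> t tT; apply: cvgD; [exact: cQw|exact: c12].
- by move=> t tT; apply: cvgD; [exact: cK'|exact: cQG2].
move=> x xt; rewrite ler_wpM2r ?sqr_ge0//.
have x0 := sqn_ge0 x; move: (sqn x) x0 xt => t t0 tt1.
have [] := bnd t (introT andP (conj t0 tt1)); rewrite -/(G t) => bG bd.
have w0 := reg1_gt0 t0; have wE := reg1E t0.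
rewrite /K /dQG /reg2 /defect /w /riccati /c -/(G t).
have -> : Psi (t + e) = G t - 2 by rewrite /G; ring.
move: (reg1 t) (G t) (dPsi (t + e)) w0 wE bG bd => a b d a0 aE bb bd.
rewrite -subr_ge0.
set D := (X in 0 <= X).
(* [C] makes the first two terms nonnegative; the last one is zero by [reg1E]. *)
have -> : D = 4 * (e * a ^+ 3) * (C - b) + 2 * (e * a ^+ 2) * (C + d)
    + 4 * a ^+ 2 * b * ((t + e) * a - 1) by rewrite /D; ring.
rewrite aE subrr mulr0 addr0.
have bC : b <= C := le_trans (ler_norm _) bb.
have dC : 0 <= C + d by move: bd; rewrite ler_norml => /andP[]; lra.
by rewrite addr_ge0// mulr_ge0// ?subr_ge0// mulr_ge0// mulr_ge0 ?exprn_ge0// ltW.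
Qed.

End rellich.

(** * The regularized Rellich inequality *)

Section rellich_main.
Context {R : realType} {N : nat}.
Local Notation V := 'rV[R]_N.
Implicit Types (f g u : V -> R) (x : V) (i j k l : 'I_N) (t : R) (Phi Psi : R -> R).

Variables (t1 T : R).
Hypothesis t1T : t1 < T.
Local Notation test := (test_below t1).
Hypothesis hN : (5 <= N)%N.

Let N5 : 5 <= N%:R :> R.
Proof. by rewrite ler_nat. Qed.

Lemma test_smooth f : test f -> smooth f.
Proof. by case. Qed.

Lemma testMM f g : test f -> test g -> test (fun x => f x * g x).
Proof. by move=> [sf _]; exact: testM. Qed.

Section sphere.
Variables (Phi dPhi : R -> R).
Hypothesis CP : C1_below T Phi dPhi.
Let cP := C1_cont_below CP.

Lemma J_rot_ibp i j f g : test f -> test g ->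
  J Phi (fun x => rot i j f x * g x) = - J Phi (fun x => f x * rot i j g x).
Proof.
move=> tf tg; apply/eqP; rewrite -addr_eq0 -(JD t1T)//; first last.
- by apply: testMM => //; exact: test_rot.
- by apply: testMM => //; exact: test_rot.
apply/eqP; rewrite -[RHS](J_rot t1T i j CP (testMM tf tg)).
by apply: eq_J => x; rewrite rotM//; exact: test_smooth.
Qed.

Lemma J_sphlap_ibp f g : test f -> test g ->
  J Phi (fun x => sphlap f x * g x) =
  - (2^-1 * \sum_i \sum_j J Phi (fun x => rot i j f x * rot i j g x)).
Proof.
move=> tf tg.
transitivity (2^-1 * J Phi (fun x => \sum_i \sum_j rot i j (rot i j f) x * g x)).
  rewrite -(JZ t1T)//; last first.
    apply: test_sum => i; apply: test_sum => j; apply: testMM => //.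
    by do 2 apply: test_rot.
  apply: eq_J => x; congr (_ * _); rewrite /sphlap -mulrA; congr (_ * _).
  by rewrite mulr_suml; apply: eq_bigr => i _; rewrite mulr_suml.
rewrite -mulrN; congr (_ * _).
rewrite (J_sum t1T)//; last first.
  by move=> i; apply: test_sum => j; apply: testMM => //; do 2 apply: test_rot.
rewrite -sumrN; apply: eq_bigr => i _.
rewrite (J_sum t1T)//; last by move=> j; apply: testMM => //; do 2 apply: test_rot.
rewrite -sumrN; apply: eq_bigr => j _.
by rewrite J_rot_ibp//; exact: test_rot.
Qed.

Lemma J_sphlap_sqr u : test u ->
  J Phi (fun x => sphlap u x ^+ 2) =
  4^-1 * \sum_k \sum_l \sum_i \sum_j J Phi (fun x => rot i j (rot k l u) x ^+ 2).
Proof.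
move=> tu; have tL := test_sphlap tu.
transitivity (J Phi (fun x => sphlap u x * sphlap u x)).
  by apply: eq_J => x; rewrite expr2.
rewrite J_sphlap_ibp// (_ : 4^-1 = 2^-1 * 2^-1 :> R); last by field.
rewrite -mulrA -mulrN; congr (_ * _).
rewrite mulr_sumr -sumrN; apply: eq_bigr => k _.
rewrite mulr_sumr -sumrN; apply: eq_bigr => l _.
have tr := test_rot k l tu.
transitivity (- J Phi (fun x => sphlap (rot k l u) x * rot k l u x)).
  congr (- _); apply: eq_J => x; congr (_ * _).
  by rewrite mulrC sphlap_rot//; exact: test_smooth tu.
by rewrite J_sphlap_ibp// opprK.
Qed.

(** This is the first nonzero eigenvalue [N - 1] of the sphere, by Bochner's
    argument: the spherical Laplacian commutes with the rotations, so that its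
    square integrates to the sum of the squares of all second rotational
    derivatives, which [sum_rot_rot] bounds from below pointwise. *)
Lemma J_sphere_gap u : test u -> (forall t, 0 <= t <= t1 -> 0 <= Phi t) ->
  (N%:R - 1) * (2^-1 * \sum_i \sum_j J Phi (fun x => rot i j u x ^+ 2)) <=
  J Phi (fun x => sphlap u x ^+ 2).
Proof.
move=> tu P0.
have trr k l i j : test (fun x => rot i j (rot k l u) x ^+ 2).
  by apply/test_sqr; do 2 apply: test_rot.
have tr i j : test (fun x => rot i j u x ^+ 2) by apply/test_sqr/test_rot.
have tL2 := test_sqr (test_sphlap tu).
have ts : test (fun x => \sum_i \sum_j rot i j u x ^+ 2).
  by apply: test_sum => i; exact: test_sum.
have trs : test (fun x => \sum_k \sum_l \sum_i \sum_j rot i j (rot k l u) x ^+ 2).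
  by do 4 (apply: test_sum => ?).
set S := \sum_i \sum_j J Phi (fun x => rot i j u x ^+ 2).
set L := J Phi (fun x => sphlap u x ^+ 2).
have ES : J Phi (fun x => \sum_i \sum_j rot i j u x ^+ 2) = S.
  rewrite (J_sum t1T)//; last by move=> i; exact: test_sum.
  by apply: eq_bigr => i _; rewrite (J_sum t1T).
have EL : J Phi (fun x => \sum_k \sum_l \sum_i \sum_j rot i j (rot k l u) x ^+ 2) = 4 * L.
  rewrite /L J_sphlap_sqr// mulrA divff// mul1r.
  rewrite (J_sum t1T)//; last by move=> k; do 3 (apply: test_sum => ?).
  apply: eq_bigr => k _.
  rewrite (J_sum t1T)//; last by move=> l; do 2 (apply: test_sum => ?).
  apply: eq_bigr => l _.
  rewrite (J_sum t1T)//; last by move=> i; apply: test_sum => ?.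
  by apply: eq_bigr => i _; rewrite (J_sum t1T).
have n1 : 0 < N%:R - 1 :> R by have := N5; lra.
have n2 : 0 < N%:R - 2 :> R by have := N5; lra.
have : J Phi (fun x => (N%:R - 1)^-1 * sphlap u x ^+ 2 +
          ((N%:R - 2) / 2) * (\sum_i \sum_j rot i j u x ^+ 2)) <=
       J Phi (fun x => 4^-1 * \sum_k \sum_l \sum_i \sum_j rot i j (rot k l u) x ^+ 2).
  apply: (le_J t1T) => //.
  - by apply: testD; exact: testZ.
  - exact: testZ.
  move=> x xt; apply: ler_wpM2l; first by apply: P0; rewrite sqn_ge0.
  have h := @sum_rot_rot R N u x (test_smooth tu) (leq_trans (isT : 1 < 5)%N hN).
  by apply: le_trans h; rewrite mulrC -mulrA.
rewrite (JD t1T) ?(JZ t1T)//; try exact: testZ.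
rewrite ES EL -/L mulrA [4^-1 * 4]mulVf// mul1r.
clear ES EL; move: S L (N%:R : R) n1 n2 => S L n n1 n2 h.
have : (n - 1) * ((n - 1)^-1 * L + (n - 2) / 2 * S) <= (n - 1) * L by rewrite ler_pM2l.
have -> : (n - 1) * ((n - 1)^-1 * L + (n - 2) / 2 * S) = L + (n - 1) * ((n - 2) / 2 * S).
  by field; rewrite gt_eqF.
move=> {}h.
rewrite -(ler_pM2l n2); lra.
Qed.

End sphere.

Variable e : R.
Hypothesis e0 : 0 < e.

Local Notation reg2 := (reg2 e).
Local Notation defect := (defect e).
Let CQ : C1_below T reg2 (fun t => - 2 * reg1 e t ^+ 3) := C1_reg2 e0 T.
Let cQ : cont_below T reg2 := C1_cont_below CQ.
Let ce3 : cont_below T defect := @cont_reg1X R e e0 T 3 e.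

Lemma reg2_ge0 t : 0 <= t -> 0 <= reg2 t.
Proof. by move=> t0; rewrite /reg2 mulr_ge0// ltW// reg1_gt0. Qed.

Lemma J_reg2_euler f : test f ->
  J reg2 (euler f) = - ((N%:R - 4) * J reg2 f + 4 * J defect f).
Proof.
move=> tf; rewrite (J_euler t1T CQ tf) -!(JlZ t1T)// -(JlD t1T)//; first last.
- by move=> t tT; apply: cvgM; [exact: cvg_cst|exact: ce3].
- by move=> t tT; apply: cvgM; [exact: cvg_cst|exact: cQ].
congr (- _); apply: eq_J => x; congr (_ * _).
have := reg1E e0 (sqn_ge0 x); rewrite /reg2 /defect /=; move: (sqn x) (reg1 e (sqn x)) => s w sw.
have -> : w * w = (s + e) * w * (w * w) by rewrite sw mul1r.
ring.
Qed.

Lemma J_reg2_sqr_euler f : test f ->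
  2 * J reg2 (fun x => f x * euler f x) =
  - ((N%:R - 4) * J reg2 (fun x => f x ^+ 2) + 4 * J defect (fun x => f x ^+ 2)).
Proof.
move=> tf; have te := test_euler tf.
rewrite -(JZ t1T)//; last exact: testMM.
rewrite -J_reg2_euler; last exact: test_sqr.
by apply: eq_J => x; rewrite euler_sqr//; exact: test_smooth tf.
Qed.

(** Here and in the next lemma, the product of a function with its Euler
    derivative is half of the Euler derivative of a square; integrating it by parts
    leaves only squares and defects. *)
Lemma J_reg2_radial g : test g ->
  J reg2 (fun x => (euler g x + (N%:R - 2) * g x) ^+ 2) =
  J reg2 (fun x => euler g x ^+ 2) + 2 * (N%:R - 2) * J reg2 (fun x => g x ^+ 2)
  - 4 * (N%:R - 2) * J defect (fun x => g x ^+ 2).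
Proof.
move=> tg; have te := test_euler tg; have E := J_reg2_sqr_euler tg.
have tge := testMM tg te.
transitivity (J reg2 (fun x => euler g x ^+ 2 +
   (2 * (N%:R - 2) * (g x * euler g x) + (N%:R - 2) ^+ 2 * g x ^+ 2))).
  by apply: eq_J => x; congr (_ * _); ring.
have t2 := test_sqr te; have t3 := test_sqr tg.
rewrite (JD t1T cQ t2 (testD (testZ _ tge) (testZ _ t3))).
rewrite (JD t1T cQ (testZ _ tge) (testZ _ t3)) !(JZ t1T _ cQ)//.
have -> : 2 * (N%:R - 2) * J reg2 (fun x => g x * euler g x) =
  (N%:R - 2) * (2 * J reg2 (fun x => g x * euler g x)) by ring.
rewrite E; ring.
Qed.

Lemma J_reg2_angular v : test v ->
  - J reg2 (fun x => (euler (euler v) x + (N%:R - 2) * euler v x) * v x) =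
  J reg2 (fun x => euler v x ^+ 2) + (N%:R - 4) * J reg2 (fun x => v x ^+ 2)
  + 4 * J defect (fun x => v x ^+ 2) + 4 * J defect (fun x => v x * euler v x).
Proof.
move=> tv; have te := test_euler tv; have E := J_reg2_sqr_euler tv.
have tve := testMM tv te; have tee := test_euler te.
have E2 := J_reg2_euler tve.
have : J reg2 (euler (fun x => v x * euler v x)) =
  J reg2 (fun x => euler v x ^+ 2) + J reg2 (fun x => euler (euler v) x * v x).
  rewrite -(JD t1T)//; first last.
  - exact: testMM.
  - exact: test_sqr.
  by apply: eq_J => x; rewrite eulerM; [congr (_ * _); ring|exact: test_smooth..].
rewrite E2 => E3.
have -> : J reg2 (fun x => (euler (euler v) x + (N%:R - 2) * euler v x) * v x) =
  J reg2 (fun x => euler (euler v) x * v x) + (N%:R - 2) * J reg2 (fun x => v x * euler v x).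
  rewrite -(JZ t1T)// -(JD t1T)//; first last.
  - exact: testZ.
  - exact: testMM.
  by apply: eq_J => x; congr (_ * _); ring.
lra.
Qed.

(** The cross term between the radial part and the spherical Laplacian is
    split over the rotations, which commute with the Euler field: each rotational
    derivative of [u] then contributes a one-dimensional radial expression. *)
Lemma J_laplacian_split u : test u ->
  J reg2 (fun x => (sqn x * lapl u x) ^+ 2) =
  J reg2 (fun x => (euler (euler u) x + (N%:R - 2) * euler u x) ^+ 2)
  + \sum_i \sum_j (- J reg2 (fun x => (euler (euler (rot i j u)) x +
       (N%:R - 2) * euler (rot i j u) x) * rot i j u x))
  + J reg2 (fun x => sphlap u x ^+ 2).
Proof.
move=> tu; have su := test_smooth tu.
pose A x := euler (euler u) x + (N%:R - 2) * euler u x.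
have tA : test A by apply: testD; [do 2 apply: test_euler|apply/testZ/test_euler].
have tL := test_sphlap tu.
transitivity (J reg2 (fun x => A x ^+ 2 + (2 * (sphlap u x * A x) + sphlap u x ^+ 2))).
  by apply: eq_J => x; rewrite sqn_lapl// /A; congr (_ * _); ring.
have tLA := testMM tL tA.
rewrite (JD t1T cQ (test_sqr tA) (testD (testZ _ tLA) (test_sqr tL))).
rewrite (JD t1T cQ (testZ _ tLA) (test_sqr tL)) (JZ t1T _ cQ tLA) addrA.
rewrite (J_sphlap_ibp CQ tu tA) mulrN mulrA divff// mul1r.
congr (_ + _ + _); rewrite -sumrN; apply: eq_bigr => i _.
rewrite -sumrN; apply: eq_bigr => j _; congr (- _); apply: eq_J => x.
congr (_ * _); rewrite mulrC; congr (_ * _).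
have sE := smooth_euler su; have sr := smooth_rot i j su.
have er : euler (rot i j u) = rot i j (euler u).
  by apply/funext => y; rewrite euler_rot.
rewrite er euler_rot//.
rewrite {1}/rot !(@pdD _ _ (euler (euler u)) (fun y => (N%:R - 2) * euler u y))//;
  try (by apply: smoothM => //; exact: smooth_cst); try exact: smooth_euler.
by rewrite !pdZ// /rot; ring.
Qed.

(** The value is immaterial; it matters only that it does not depend on the
    regularization. *)
Definition rellich_error u (C : R) : R :=
  2 * C * hess_energy (euler u)
  + (4 * C + 4 * (N%:R - 2)) * (\sum_k hess_energy (pd k u))
  + \sum_i \sum_j ((C + N%:R) * hess_energy (rot i j u)
     + 4 * (C + N%:R) * (\sum_k hess_energy (pd k u))
     + 4 * (\sum_k hess_energy (pd k (euler u)))).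

(** The inequality [hardy_riccati] is applied to the Euler derivative of [u]
    and, with half of the weight, to each of its rotational derivatives; the other
    half is spent on the plain Hardy inequality, and the sphere contributes
    [J_sphere_gap]. The remaining coefficient of the square of a rotational
    derivative is half of [N ^ 2 / 4 - N - 1], which is positive exactly because
    [5 <= N]. *)
Lemma rellich_regularized (Psi dPsi : R -> R) (C : R) u : test u ->
  C1_below T (fun t => Psi (t + e)) (fun t => dPsi (t + e)) ->
  (forall t, 0 <= t <= t1 -> `|2 + Psi (t + e)| <= C /\ `|dPsi (t + e)| <= C) ->
  0 <= C ->
  J (fun t => reg2 t * @riccati R N Psi dPsi (t + e)) (fun x => sqn x * gradsq u x)
    - rellich_error u C * e <= J (fun=> 1) (fun x => lapl u x ^+ 2).
Proof.
move=> tu CPsi bnd C0; have su := test_smooth tu.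
have tg := test_euler tu; have tv i j := test_rot i j tu.
pose W t := reg2 t * @riccati R N Psi dPsi (t + e).
have cW : cont_below T W.
  have cp := C1_cont_below CPsi; have [_ cd] := CPsi.
  move=> t tT; apply: cvgM; first exact: cQ.
  have p := cp t tT; have dp := cd t tT.
  apply: cvgB; last exact: (continuous_comp p (@exprn_continuous R 2 _)).
  apply: cvgB; last by apply: cvgM => //; exact: cvg_cst.
  apply: cvgN; apply: cvgM => //; apply: cvgM; first exact: cvg_cst.
  by apply: cvgD; [exact: cvg_id|exact: cvg_cst].
set K1 := \sum_k hess_energy (pd k u).
set K2 := \sum_k hess_energy (pd k (euler u)).
have h0 : J reg2 (fun x => (sqn x * lapl u x) ^+ 2) <= J (fun=> 1) (fun x => lapl u x ^+ 2).
  apply: (le_J t1T) => //.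
  - exact: C1_cont_below (C1_cst T 1).
  - by apply/test_sqr/testM; [exact: smooth_sqn|exact: test_lapl].
  - by apply/test_sqr/test_lapl.
  move=> x _; rewrite exprMn mulrA ler_wpM2r ?sqr_ge0//.
  have /andP[w0 reg1'] := reg1_le1 e0 (sqn_ge0 x).
  have -> : reg2 (sqn x) * sqn x ^+ 2 = (sqn x * reg1 e (sqn x)) ^+ 2 by rewrite /reg2; ring.
  by rewrite expr_le1.
apply: le_trans h0; rewrite J_laplacian_split// J_reg2_radial//.
have bg : J reg2 (fun x => euler u x ^+ 2) <= hess_energy (euler u) by exact: (hardy_reg2 t1T).
have eg : J defect (fun x => euler u x ^+ 2) <= 1 * K1 * e.
  by apply: (J_defect_le t1T e0 hN tg tu) => // x; rewrite mul1r euler_sqr_le.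
have hg := hardy_riccati t1T e0 tg CPsi bnd.
have gap := J_sphere_gap CQ tu (fun t tt => reg2_ge0 (proj1 (andP tt))).
have q0 f : test f -> 0 <= J reg2 (fun x => f x ^+ 2).
  move=> [_ f0]; apply: (@J_ge0 _ _ t1).
  - by move=> x _; apply: reg2_ge0; exact: sqn_ge0.
  - by move=> x; exact: sqr_ge0.
  - by move=> x /f0 ->; rewrite expr0n.
have e30 f : test f -> 0 <= J defect (fun x => f x ^+ 2).
  move=> [_ f0]; apply: (@J_ge0 _ _ t1).
  - move=> x _; have w0 := ltW (reg1_gt0 e0 (sqn_ge0 x)).
    by rewrite mulr_ge0 ?exprn_ge0// ltW.
  - by move=> x; exact: sqr_ge0.
  - by move=> x /f0 ->; rewrite expr0n.
have ang i j : 2^-1 * J W (fun x => rot i j u x ^+ 2)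
    - ((C + N%:R) * hess_energy (rot i j u) + 4 * (C + N%:R) * K1 + 4 * K2) * e
  <= - J reg2 (fun x => (euler (euler (rot i j u)) x + (N%:R - 2) * euler (rot i j u) x) * rot i j u x)
     + (N%:R - 1) * 2^-1 * J reg2 (fun x => rot i j u x ^+ 2).
  have tr := tv i j; rewrite J_reg2_angular//.
  have a1 := hardy_riccati t1T e0 tr CPsi bnd.
  (* This [Psi] yields the constant weight [N ^ 2 / 4]; here [N] bounds
     [`|2 - N / 2|]. *)
  have a2 : J (fun t => reg2 t * @riccati R N (fun=> - (N%:R / 2)) (fun=> 0) (t + e))
      (fun x => rot i j u x ^+ 2)
    - (2 * (N%:R - 2) + 2 * N%:R * e) * J reg2 (fun x => rot i j u x ^+ 2)
    - 4 * N%:R * J defect (fun x => rot i j u x ^+ 2)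
    <= J reg2 (fun x => euler (rot i j u) x ^+ 2).
    apply: (hardy_riccati t1T e0 tr); first exact: C1_cst.
    move=> t _; split; last by rewrite normr0; have := N5; lra.
    by rewrite ler_norml; apply/andP; split; have := N5; lra.
  have a3 : J (fun t => reg2 t * @riccati R N (fun=> - (N%:R / 2)) (fun=> 0) (t + e))
      (fun x => rot i j u x ^+ 2) = N%:R ^+ 2 / 4 * J reg2 (fun x => rot i j u x ^+ 2).
    rewrite -(JlZ t1T _ cQ (test_sqr tr)); apply: eq_J => x; rewrite /riccati.
    by move: (sqn x) (rot i j u x) (N%:R : R) (reg2 (sqn x)) => s b n a; field.
  rewrite a3 in a2.
  have bv : J reg2 (fun x => rot i j u x ^+ 2) <= hess_energy (rot i j u) by exact: (hardy_reg2 t1T).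
  have ev : J defect (fun x => rot i j u x ^+ 2) <= 2 * K1 * e.
    by apply: (J_defect_le t1T e0 hN tr tu) => // x; exact: rot_sqr_le.
  have er : euler (rot i j u) = rot i j (euler u).
    by apply/funext => y; rewrite euler_rot.
  have eE : J defect (fun x => euler (rot i j u) x ^+ 2) <= 2 * K2 * e.
    apply: (J_defect_le t1T e0 hN (test_euler tr) tg) => //.
    by move=> x; rewrite er; exact: rot_sqr_le.
  have te := test_euler tr.
  have ex : - (2^-1) * J defect (fun x => rot i j u x ^+ 2) + - (2^-1) * J defect (fun x => euler (rot i j u) x ^+ 2)
      <= J defect (fun x => rot i j u x * euler (rot i j u) x).
    rewrite -!(JZ t1T _ ce3 (test_sqr _))//.
    rewrite -(JD t1T ce3 (testZ _ (test_sqr tr)) (testZ _ (test_sqr te))).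
    apply: (le_J t1T) => //.
    - by apply: testD; apply/testZ/test_sqr.
    - exact: testMM.
    move=> x _; apply: ler_wpM2l.
      by rewrite mulr_ge0// ?exprn_ge0// ltW// reg1_gt0// sqn_ge0.
    have := sqr_ge0 (rot i j u x + euler (rot i j u) x).
    by move: (rot i j u x) (euler (rot i j u) x) => a b; nra.
  have qv0 := q0 _ tr; have ev0 := e30 _ tr.
  move: (J W _) (J reg2 (fun x => rot i j u x ^+ 2)) (J defect (fun x => rot i j u x ^+ 2))
    (J reg2 (fun x => euler (rot i j u) x ^+ 2)) (J defect (fun x => euler (rot i j u) x ^+ 2))
    (J defect (fun x => rot i j u x * euler (rot i j u) x)) (hess_energy (rot i j u))
    a1 a2 bv ev eE ex qv0 ev0 => w q ee a eb x B a1 a2 bv ev eE ex qv0 ev0.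
  have n5 := N5; have e0' := ltW e0.
  have m0 : 0 <= C + N%:R by rewrite addr_ge0.
  have m1 : (C + N%:R) * e * q <= (C + N%:R) * e * B.
    by apply: ler_wpM2l => //; exact: mulr_ge0.
  have m2 : (C + N%:R) * ee <= (C + N%:R) * (2 * K1 * e) by apply: ler_wpM2l.
  have m3 : 0 <= (N%:R ^+ 2 / 4 - N%:R - 1) * q.
    by apply: mulr_ge0 => //; nra.
  lra.
have tg2 := test_sqr tg; have tv2 i j := test_sqr (tv i j).
have EW : J W (fun x => sqn x * gradsq u x) = J W (fun x => euler u x ^+ 2) +
   2^-1 * \sum_i \sum_j J W (fun x => rot i j u x ^+ 2).
  have tS : test (fun x => \sum_i \sum_j rot i j u x ^+ 2).
    by apply: test_sum => i; exact: test_sum.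
  transitivity (J W (fun x => euler u x ^+ 2 + 2^-1 * \sum_i \sum_j rot i j u x ^+ 2)).
    by apply: eq_J => x; rewrite sqn_gradsq.
  rewrite (JD t1T cW tg2 (testZ _ tS)) (JZ t1T _ cW tS); congr (_ + _ * _).
  rewrite (J_sum t1T _ cW); last by move=> i; exact: test_sum.
  by apply: eq_bigr => i _; rewrite (J_sum t1T _ cW).
rewrite -/W EW /rellich_error -/K1 -/K2.
have sum2 (a b : 'I_N -> 'I_N -> R) (c d : R) :
    \sum_i \sum_j (c * a i j + d * b i j) =
    c * (\sum_i \sum_j a i j) + d * (\sum_i \sum_j b i j).
  rewrite !mulr_sumr -big_split/=; apply: eq_bigr => i _.
  by rewrite !mulr_sumr -big_split.
pose D i j := (C + N%:R) * hess_energy (rot i j u) + 4 * (C + N%:R) * K1 + 4 * K2.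
pose A i j := - J reg2 (fun x => (euler (euler (rot i j u)) x +
  (N%:R - 2) * euler (rot i j u) x) * rot i j u x).
pose q i j := J reg2 (fun x => rot i j u x ^+ 2).
pose w i j := J W (fun x => rot i j u x ^+ 2).
have {ang} : \sum_i \sum_j (2^-1 * w i j + (- e) * D i j) <=
    \sum_i \sum_j (1 * A i j + ((N%:R - 1) * 2^-1) * q i j).
  apply: ler_sum => i _; apply: ler_sum => j _.
  by rewrite mul1r mulNr [e * _]mulrC; exact: ang.
rewrite !sum2 -/(A _ _) => ang.
have h1 : 2 * C * e * J reg2 (fun x => euler u x ^+ 2) <= 2 * C * e * hess_energy (euler u).
  by apply: ler_wpM2l => //; rewrite !mulr_ge0// ltW.
have n5 := N5.
have h2 : (4 * C + 4 * (N%:R - 2)) * J defect (fun x => euler u x ^+ 2) <=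
    (4 * C + 4 * (N%:R - 2)) * (1 * K1 * e).
  by apply: ler_wpM2l => //; lra.
rewrite -/(\sum_i \sum_j w i j) -/(\sum_i \sum_j D i j) -/(\sum_i \sum_j A i j).
rewrite -/(\sum_i \sum_j q i j) in gap.
rewrite -/W in hg.
move: (\sum_i \sum_j w i j) (\sum_i \sum_j D i j) (\sum_i \sum_j A i j)
  (\sum_i \sum_j q i j) (J W _) (J reg2 (fun x => sphlap u x ^+ 2)) ang gap hg h1 h2.
move: (J reg2 (fun x => euler u x ^+ 2)) (J defect (fun x => euler u x ^+ 2))
  (J reg2 (fun x => euler (euler u) x ^+ 2)) (hess_energy (euler u)).
move=> qg eg' ag Bg Sw SD SA Sq wg L ang gap hg h1 h2.
lra.
Qed.

End rellich_main.

(** * Removal of the regularization *)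

Section rellich_limit.
Context {R : realType} {N : nat}.
Local Notation V := 'rV[R]_N.
Implicit Types (f g u : V -> R) (x : V) (i j k l : 'I_N) (t s : R) (Psi dPsi : R -> R).
Local Notation mu := (lebesgue_rV N).
Local Notation riccati := (@riccati R N).

Lemma limn_einf_le_cvg (a b : (\bar R)^nat) (l : \bar R) :
  (forall n, (a n <= b n)%E) -> b @ \oo --> l -> (limn_einf a <= l)%E.
Proof.
move=> ab bl; rewrite limn_einf_lim -(cvg_lim _ bl)//.
apply: lee_lim; [exact: is_cvg_einfs|by apply/cvg_ex; exists l|].
apply: nearW => n; apply: le_trans (ab n); apply: ereal_inf_lbound.
by exists n => //=.
Qed.

(** The regularity and local boundedness of [Psi] that survive the shift of
    the variable by the regularization. Nothing is asked at [s = 0]. *)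
Definition riccati_below (T : R) Psi dPsi :=
  [/\ forall s, 0 < s < T -> is_derive s 1 Psi (dPsi s) /\ {for s, continuous dPsi},
      forall T', T' < T -> exists C : R, forall s, 0 < s <= T' ->
        `|2 + Psi s| <= C /\ `|dPsi s| <= C
    & forall s, 0 < s < T -> 0 <= riccati Psi dPsi s].

Lemma riccati_continuous T Psi dPsi s : riccati_below T Psi dPsi -> 0 < s < T ->
  {for s, continuous (riccati Psi dPsi)}.
Proof.
move=> [h _ _] sT; have [d c] := h s sT.
have p := continuous_derive d.
apply: cvgB; last exact: (continuous_comp p (@exprn_continuous R 2 _)).
apply: cvgB; last by apply: cvgM => //; exact: cvg_cst.
apply: cvgN; apply: cvgM => //; apply: cvgM; first exact: cvg_cst.
exact: cvg_id.
Qed.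

Lemma C1_below_shift T Psi dPsi (e : R) : riccati_below T Psi dPsi -> 0 < e ->
  C1_below (T - e) (fun t => Psi (t + e)) (fun t => dPsi (t + e)).
Proof.
move=> [h _ _] e0.
have sh t : 0 <= t < T - e -> 0 < t + e < T.
  by move=> /andP[t0 tT]; apply/andP; split; lra.
have dte t : is_derive t 1 (fun t : R => t + e) (1 + 0).
  exact: (@is_deriveD _ _ _ id (cst e)).
split=> t tT; have [d c] := h _ (sh t tT).
  have -> : dPsi (t + e) = dPsi (t + e) * (1 + 0) by rewrite addr0 mulr1.
  exact: (@is_derive1_comp _ Psi (fun t => t + e)).
apply: (@continuous_comp _ _ _ (fun t => t + e) dPsi) => //.
exact: continuous_derive (dte t).
Qed.

Definition rellich_density Psi dPsi u x : R :=
  riccati Psi dPsi (sqn x) / sqn x * gradsq u x.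

Lemma gradsq_ge0 u x : 0 <= gradsq u x.
Proof. by apply: sumr_ge0 => k _; exact: sqr_ge0. Qed.

(** The regularized inequalities have nonnegative integrands that converge
    pointwise and an error of order [e]; Fatou's lemma concludes. The limit at the
    origin also agrees, because of the convention [x / 0 = 0]. *)
Theorem rellich_riccati T t1 Psi dPsi u : (5 <= N)%N -> t1 < T ->
  test_below t1 u -> riccati_below T Psi dPsi ->
  measurable_fun setT (rellich_density Psi dPsi u) /\
  (\int[mu]_x (rellich_density Psi dPsi u x)%:E <= \int[mu]_x (lapl u x ^+ 2)%:E)%E.
Proof.
move=> hN t1T tu rT; have su := test_smooth tu.
have [rd rb r0] := rT.
(* The shifted variable stays below [t1 + d < T] on the support of [u], where
   [Psi] and [dPsi] are bounded. *)
pose d := (T - t1) / 2.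
have d0 : 0 < d by rewrite divr_gt0// subr_gt0.
have dT : t1 + d < T by rewrite /d; lra.
have [C0 C0P] := rb _ dT; pose C := `|C0|.
pose e n : R := d * harmonic n.
have e0 n : 0 < e n by rewrite mulr_gt0// /harmonic/= invr_gt0 ltr0n.
have ed n : e n <= d.
  have h1 : @harmonic R n <= 1 by rewrite /harmonic /= invf_le1 ?ltr0n// ler1n.
  by rewrite /e ler_piMr// ltW.
have tT n : t1 < T - e n by have := ed n; lra.
have CP n := C1_below_shift rT (e0 n).
have bnd n t : 0 <= t <= t1 -> `|2 + Psi (t + e n)| <= C /\ `|dPsi (t + e n)| <= C.
  move=> /andP[t0 tt]; have := ed n; have := e0 n => en0 end'.
  have [] := C0P (t + e n); first by apply/andP; split; lra.
  by move=> h1 h2; split; [exact: le_trans h1 (ler_norm _)|exact: le_trans h2 (ler_norm _)].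
pose g x := sqn x * gradsq u x.
have tg : test_below t1 g by apply: testM; [exact: smooth_sqn|exact: test_gradsq].
pose F n x := reg2 (e n) (sqn x) * riccati Psi dPsi (sqn x + e n) * g x.
have cw n : cont_below (T - e n) (fun t => reg2 (e n) t * riccati Psi dPsi (t + e n)).
  move=> t /andP[t0 tTn]; apply: cvgM.
    exact: (C1_cont_below (C1_reg2 (e0 n) (T - e n))) (introT andP (conj t0 tTn)).
  apply: (@continuous_comp _ _ _ (fun t => t + e n) (riccati Psi dPsi)).
    by apply: cvgD; [exact: cvg_id|exact: cvg_cst].
  apply: riccati_continuous rT _; have := e0 n.
  by move=> en0; apply/andP; split; lra.
have intF n := J_integrable (tT n) (cw n) tg.
have F0 n x : 0 <= F n x.
  rewrite /F; have [xt|tx] := leP (sqn x) t1; last first.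
    by case: tg => _ ->//; rewrite mulr0.
  have x0 := sqn_ge0 x; have := ed n; have := e0 n => en0 end'.
  rewrite mulr_ge0 ?mulr_ge0 ?gradsq_ge0//.
  - by rewrite ltW// reg1_gt0.
  - by rewrite ltW// reg1_gt0.
  - by apply: r0; apply/andP; split; lra.
have e_cvg : e @ \oo --> (0 : R).
  by rewrite -[X in _ --> X](mulr0 d); apply: cvgM; [exact: cvg_cst|exact: cvg_harmonic].
have Fcvg x : F ^~ x @ \oo --> rellich_density Psi dPsi u x.
  have [xt|tx] := leP (sqn x) t1; last first.
    have gx0 : g x = 0 by case: tg => _ ->.
    have ux0 : gradsq u x = 0 by case: (test_gradsq tu) => _ ->.
    rewrite /F /rellich_density gx0 ux0 mulr0.
    by under eq_fun do rewrite mulr0; exact: cvg_cst.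
  have [x0|x0] := eqVneq (sqn x) 0.
    rewrite /F /rellich_density /g x0 invr0 mulr0 !mul0r.
    by under eq_fun do rewrite mulr0; exact: cvg_cst.
  have xp : 0 < sqn x by rewrite lt_neqAle eq_sym x0 sqn_ge0.
  have se : (fun n => sqn x + e n) @ \oo --> sqn x.
    by rewrite -[X in _ --> X]addr0; apply: cvgD => //; exact: cvg_cst.
  have sV : (fun n => reg1 (e n) (sqn x)) @ \oo --> (sqn x)^-1 by exact: cvgV.
  have -> : rellich_density Psi dPsi u x =
    (sqn x)^-1 * (sqn x)^-1 * riccati Psi dPsi (sqn x) * g x.
    by rewrite /rellich_density /g; field.
  apply: cvgM; last exact: cvg_cst.
  apply: cvgM; first exact: cvgM.
  have cr : {for sqn x, continuous (riccati Psi dPsi)}.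
    by apply: riccati_continuous rT _; rewrite xp (le_lt_trans xt).
  exact: (continuous_cvg _ cr).
have mF n : measurable_fun setT (F n).
  by have /integrableP[/measurable_EFinP + _] := intF n.
split; first by apply: (measurable_fun_cvg mF) => x _; exact: Fcvg.
have tl := test_sqr (test_lapl tu).
have c1 : cont_below T (fun=> 1 : R) := C1_cont_below (C1_cst T 1).
have intl := J_integrable t1T c1 tl.
have El : (\int[mu]_x (lapl u x ^+ 2)%:E = (J (fun=> 1) (fun x => lapl u x ^+ 2))%:E)%E.
  rewrite /J /Rintegral fineK; last exact: integrable_fin_num intl.
  by apply: eq_integral => x _; rewrite mul1r.
rewrite El.
have EF n : (\int[mu]_x (F n x)%:E)%E = (J (fun t => reg2 (e n) t * riccati Psi dPsi (t + e n)) g)%:E.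
  by rewrite /J /Rintegral fineK//; exact: integrable_fin_num (intF n).
apply: (@le_trans _ _ (limn_einf (fun n => \int[mu]_x (F n x)%:E)%E)).
  have := @fatou _ _ _ mu setT measurableT (fun n x => (F n x)%:E)
    (fun n => (measurable_EFinP _ _).2 (mF n)) (fun n x _ => (F0 n x : (0 <= (F n x)%:E)%E)).
  rewrite (@eq_integral _ _ _ mu setT (fun x => (rellich_density Psi dPsi u x)%:E))//.
  move=> x _; apply: (@cvg_limn_einf_sup _ _ _ _).1.
  by apply: cvg_EFin; [exact: nearW|exact: Fcvg].
pose L := J (fun=> 1) (fun x => lapl u x ^+ 2).
apply: (@limn_einf_le_cvg _ (fun n => (L + rellich_error u C * e n)%:E)).
  move=> n; rewrite EF lee_fin -lerBlDr.
  exact: (rellich_regularized (tT n) hN (e0 n) tu (CP n) (bnd n) (normr_ge0 _)).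
apply: cvg_EFin; first exact: nearW.
rewrite -[X in _ --> X]addr0 -(mulr0 (rellich_error u C)).
by apply: cvgD; [exact: cvg_cst|apply: cvgM; [exact: cvg_cst|exact: e_cvg]].
Qed.

End rellich_limit.

(** * The Bessel function as an entire series *)

Section entire_series.
Context {R : realType}.
Implicit Types (a : R^nat) (t x : R).

(** Coefficients dominated by those of the exponential: this bound is stable
    under formal differentiation. *)
Definition exp_dominated a := forall k, `|a k| <= (k`!%:R)^-1.

Lemma exp_dominated_diffs a : exp_dominated a -> exp_dominated (pseries_diffs a).
Proof.
move=> ha k; rewrite /pseries_diffs normrM normr_nat.
rewrite (le_trans (ler_wpM2l _ (ha k.+1)))// factS natrM invfM mulrA divff ?mul1r//.
Qed.

Lemma cvg_pseries_dominated a t : exp_dominated a -> cvgn (pseries a t).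
Proof.
move=> ha; apply: normed_cvg; rewrite /normed_series_of.
apply: (@series_le_cvg _ _ (exp_coeff `|t|)).
- by move=> k; exact: normr_ge0.
- by move=> k; apply: exp_coeff_ge0; exact: normr_ge0.
- by move=> k; rewrite /exp_coeff /= normrM normrX mulrC ler_wpM2l.
- exact: is_cvg_series_exp_coeff.
Qed.

Definition psum a t : R := limn (pseries a t).

Lemma psum_derive a t : exp_dominated a ->
  is_derive t 1 (psum a) (psum (pseries_diffs a) t).
Proof.
move=> ha; have ha' := exp_dominated_diffs ha; have ha'' := exp_dominated_diffs ha'.
apply: (@pseries_snd_diffs R a (`|t| + 1)); try exact: cvg_pseries_dominated.
by rewrite [ltRHS]ger0_norm ?ltrDl// addr_ge0.
Qed.

Lemma psum_continuous a t : exp_dominated a -> {for t, continuous (psum a)}.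
Proof. by move=> ha; apply: continuous_derive (psum_derive t ha). Qed.

Lemma psum0 a : psum a 0 = a 0%N.
Proof.
apply/cvg_lim => //; apply: cvg_near_cst; exists 1%N => // n /= n1.
rewrite /pseries /series/= -(prednK n1) big_nat_recl//= expr0 mulr1.
by rewrite big1 ?addr0// => i _; rewrite exprS mul0r mulr0.
Qed.

Lemma psum_shift a t : exp_dominated a ->
  psum (fun k => k%:R * a k) t = t * psum (pseries_diffs a) t.
Proof.
move=> ha; apply/cvg_lim => //; rewrite -cvg_shiftS.
have -> : (fun n => pseries (fun k => k%:R * a k) t n.+1) =
          (fun n => t * pseries (pseries_diffs a) t n).
  apply/funext => n; rewrite /pseries /series/= big_nat_recl// !mul0r add0r mulr_sumr.
  by apply: eq_bigr => i _; rewrite /pseries_diffs exprS; ring.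
apply: cvgM; first exact: cvg_cst.
exact: (@cvg_pseries_dominated _ t (exp_dominated_diffs ha)).
Qed.

Lemma psumZ (c : R) a t : exp_dominated a ->
  psum (fun k => c * a k) t = c * psum a t.
Proof.
move=> ha; apply/cvg_lim => //.
have -> : pseries (fun k => c * a k) t = (fun n => c * pseries a t n).
  apply/funext => n; rewrite /pseries /series/= mulr_sumr.
  by apply: eq_bigr => i _; rewrite mulrA.
by apply: cvgM; [exact: cvg_cst|exact: cvg_pseries_dominated].
Qed.

(** The coefficients of [j], where [bessel_J0 x = j (x ^+ 2)]. *)
Definition bessel_coeff k : R := (-1) ^+ k / (k`!%:R) ^+ 2 / 4 ^+ k.

Lemma bessel_coeff_le k : `|bessel_coeff k| <= (k`!%:R ^+ 2)^-1.
Proof.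
have f0 : 0 < k`!%:R :> R by rewrite ltr0n fact_gt0.
have p1 : 1 <= 4 ^+ k :> R by rewrite exprn_ege1// ler1n.
have p0 := lt_le_trans (ltr01 : 0 < (1 : R)) p1.
rewrite /bessel_coeff 2!normrM normrX normrN1 expr1n mul1r.
have i2 : 0 <= ((k`!%:R : R) ^+ 2)^-1 by rewrite invr_ge0 exprn_ge0// ltW.
have i4 : 0 <= (4 ^+ k : R)^-1 by rewrite invr_ge0 ltW.
by rewrite (ger0_norm i2) (ger0_norm i4) ler_piMr// invf_le1.
Qed.

Lemma bessel_coeff_dominated : exp_dominated bessel_coeff.
Proof.
move=> k; apply: le_trans (bessel_coeff_le k) _.
have f1 : 1 <= k`!%:R :> R by rewrite ler1n fact_gt0.
have f0 := lt_le_trans (ltr01 : 0 < (1 : R)) f1.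
by rewrite lef_pV2 ?posrE ?exprn_gt0// expr2 ler_peMl// ltW.
Qed.

Definition bessel_j t : R := psum bessel_coeff t.
Definition bessel_j' t : R := psum (pseries_diffs bessel_coeff) t.

Lemma bessel_J0E x : bessel_J0 x = bessel_j (x ^+ 2).
Proof.
rewrite /bessel_J0 /bessel_j /psum; congr (limn _); congr series; apply/funext => k.
rewrite /bessel_J0_term /bessel_coeff exprM expr_div_n.
have -> : (2 : R) ^+ 2 = 4 by ring.
by rewrite expr_div_n [LHS]mulrA [LHS]mulrAC.
Qed.

Lemma bessel_j_derive t : is_derive t 1 bessel_j (bessel_j' t).
Proof. exact/psum_derive/bessel_coeff_dominated. Qed.

Lemma bessel_j'_continuous t : {for t, continuous bessel_j'}.
Proof. exact/psum_continuous/exp_dominated_diffs/bessel_coeff_dominated. Qed.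

(** With [y x = j (x ^ 2)] and [t = x ^ 2], Bessel's equation
    [x^2 y'' + x y' + x^2 y = 0] reads [(t j')' = - j / 4]; the coefficients
    satisfy it term by term. *)
Lemma bessel_equation t : is_derive t 1 (fun t => t * bessel_j' t) (- (4^-1) * bessel_j t).
Proof.
have hb := bessel_coeff_dominated.
have hk : exp_dominated (fun k => k%:R * bessel_coeff k).
  move=> k; rewrite normrM normr_nat.
  have f0 : 0 < k`!%:R :> R by rewrite ltr0n fact_gt0.
  apply: (@le_trans _ _ (k`!%:R * (k`!%:R ^+ 2)^-1)).
    by rewrite ler_pM ?normr_ge0// ?bessel_coeff_le// ler_nat fact_geq.
  by rewrite expr2 invfM mulrA divff ?mul1r// gt_eqF.
have E : (fun t => t * bessel_j' t) = psum (fun k => k%:R * bessel_coeff k).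
  by apply/funext => s; rewrite psum_shift.
rewrite E /bessel_j -psumZ//.
have -> : (fun k => - (4^-1) * bessel_coeff k) = pseries_diffs (fun k => k%:R * bessel_coeff k).
  apply/funext => k; rewrite /pseries_diffs /bessel_coeff factS natrM.
  have f0 : k`!%:R != 0 :> R by rewrite pnatr_eq0 -lt0n fact_gt0.
  have k0 : k.+1%:R != 0 :> R by rewrite pnatr_eq0.
  have p0 : 4 ^+ k != 0 :> R by rewrite expf_neq0.
  rewrite !exprS; move: (_ ^+ k) (4 ^+ k) (k`!%:R : R) (k.+1%:R : R) f0 k0 p0 => e p f n f0 n0 p0.
  by field; rewrite f0 n0 p0.
exact: psum_derive.
Qed.

(** The function [j] starts at [1] and has no zero before [z0 ^ 2]. *)
Lemma bessel_j_gt0 z0 t : first_positive_zero bessel_J0 z0 -> 0 <= t < z0 ^+ 2 -> 0 < bessel_j t.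
Proof.
move=> [z00 _ zP] /andP[t0 tz].
have bj0 : bessel_j 0 = 1.
  by rewrite /bessel_j psum0 /bessel_coeff fact0 !expr0 expr1n invr1 !mulr1.
have nz s : 0 < s < z0 ^+ 2 -> bessel_j s != 0.
  move=> /andP[s0 sz]; rewrite -(sqr_sqrtr (ltW s0)) -bessel_J0E; apply: zP.
  rewrite sqrtr_gt0 s0/= -(ger0_norm (ltW z00)) -sqrtr_sqr ltr_sqrt//.
  by rewrite exprn_gt0.
rewrite ltNge; apply/negP => bt.
have t00 : 0 < t.
  rewrite lt_neqAle t0 andbT; apply/eqP => t0'.
  by move: bt; rewrite -t0' bj0 ler10.
have cb : {within `[0, t], continuous bessel_j}.
  by apply: continuous_subspaceT => s; exact: continuous_derive (bessel_j_derive s).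
have [|c] := @IVT R bessel_j 0 t 0 t0 cb.
  by rewrite bj0 ge_min le_max ler01 bt orbT.
rewrite in_itv/= => /andP[c0 ct] bc.
suff cz : 0 < c < z0 ^+ 2 by have := nz c cz; rewrite bc eqxx.
rewrite (le_lt_trans ct tz) andbT lt_neqAle c0 andbT; apply/eqP => c0'.
by move: bc; rewrite -c0' bj0 => /eqP; rewrite oner_eq0.
Qed.

End entire_series.

(** * Solutions of the Riccati equation *)

Section riccati_solutions.
Context {R : realType} {N : nat}.
Local Notation riccati := (@riccati R N).
Local Notation riccati_below := (@riccati_below R N).

(** This is the case [phi = |x| ^ (- N / 2)], the critical Hardy power in
    dimension [N + 2]. *)
Lemma riccati_cst s : riccati (fun=> - (N%:R / 2)) (fun=> 0) s = N%:R ^+ 2 / 4.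
Proof. by rewrite /riccati; field. Qed.

Lemma riccati_below_cst T : riccati_below T (fun=> - (N%:R / 2)) (fun=> 0).
Proof.
split.
- by move=> s _; split; [exact: is_derive_cst|exact: cvg_cst].
- move=> T' _; exists (`|2 - N%:R / 2|) => s _; split=> //.
  by rewrite normr0.
- by move=> s _; rewrite riccati_cst divr_ge0// sqr_ge0.
Qed.

Lemma bounded_below (T : R) (f : R -> R) :
  (forall s, 0 <= s < T -> {for s, continuous f}) ->
  forall T', T' < T -> exists C : R, forall s, 0 < s <= T' -> `|f s| <= C.
Proof.
move=> cf T' TT; have [T0|T0] := leP T' 0.
  by exists 0 => s /andP[s0 sT]; have := lt_le_trans s0 (le_trans sT T0); rewrite ltxx.
have cn : {within `[0, T'], continuous (fun s => `|f s|)}.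
  apply: continuous_in_subspaceT => s; rewrite inE/= in_itv/= => /andP[s0 sT].
  apply: continuous_comp; last exact: norm_continuous.
  by apply: cf; rewrite s0 (le_lt_trans sT).
have [c _ cmax] := EVT_max (ltW T0) cn.
by exists `|f c| => s /andP[s0 sT]; apply: cmax; rewrite in_itv/= ltW.
Qed.

Lemma riccati_below_continuous (T : R) (Psi dPsi : R -> R) :
  (forall s, 0 < s < T -> is_derive s 1 Psi (dPsi s)) ->
  (forall s, 0 <= s < T -> {for s, continuous Psi}) ->
  (forall s, 0 <= s < T -> {for s, continuous dPsi}) ->
  (forall s, 0 < s < T -> 0 <= riccati Psi dPsi s) ->
  riccati_below T Psi dPsi.
Proof.
move=> d c c' r0; split=> //.
  by move=> s sT; split; [exact: d|apply: c'; case/andP: sT => /ltW -> ->].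
move=> T' TT.
have [|C1 H1] := @bounded_below T (fun s => 2 + Psi s) _ _ TT.
  by move=> s sT; apply: cvgD; [exact: cvg_cst|exact: c].
have [C2 H2] := bounded_below c' TT.
exists (`|C1| + `|C2|) => s sT; split.
  by apply: le_trans (H1 s sT) _; rewrite (le_trans (ler_norm _))// lerDl.
by apply: le_trans (H2 s sT) _; rewrite (le_trans (ler_norm _))// lerDr.
Qed.

Section ball.
Variable r : R.
Hypothesis r0 : 0 < r.
Hypothesis hN : (2 <= N)%N.

(** The radial function behind this case is
    [phi = (|x| ^ - N - r ^ - N) ^ (1 / 2)], which vanishes on the sphere of radius
    [r]; its logarithmic derivative is [- (N / 2) * ball_factor]. *)
Definition ball_factor (s : R) : R := (1 - (Num.sqrt s / r) ^+ N)^-1.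
Definition Psi_ball s := - (N%:R / 2) * ball_factor s.
Definition dPsi_ball s := - (N%:R ^+ 2 / 4 / r ^+ 2) * (Num.sqrt s / r) ^+ (N - 2) * ball_factor s ^+ 2.

Lemma ball_factor_den_gt0 s : 0 <= s < r ^+ 2 -> 0 < 1 - (Num.sqrt s / r) ^+ N.
Proof.
move=> /andP[s0 sr].
have z0 : 0 <= Num.sqrt s / r by rewrite divr_ge0 ?sqrtr_ge0// ltW.
have z1 : Num.sqrt s / r < 1.
  rewrite ltr_pdivrMr// mul1r -[ltRHS](ger0_norm (ltW r0)) -sqrtr_sqr ltr_sqrt//.
  by rewrite exprn_gt0.
have n0 : N != 0%N by case: N hN.
by rewrite subr_gt0 exprn_ilt1.
Qed.

Lemma riccati_ball s : 0 < s < r ^+ 2 ->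
  riccati Psi_ball dPsi_ball s = N%:R ^+ 2 / 4 * ball_factor s ^+ 2.
Proof.
move=> /andP[s0 sr]; have := ball_factor_den_gt0 (introT andP (conj (ltW s0) sr)).
rewrite /riccati /Psi_ball /dPsi_ball /ball_factor.
have -> : (Num.sqrt s / r) ^+ N = s / r ^+ 2 * (Num.sqrt s / r) ^+ (N - 2).
  by rewrite -{1}(subnKC hN) exprD expr_div_n sqr_sqrtr// ltW.
have r2 : r != 0 by rewrite gt_eqF.
move: (_ ^+ (N - 2)) (N%:R : R) => w n d0.
have d1 : 1 - s / r ^+ 2 * w != 0 by rewrite gt_eqF.
field; rewrite r2/=; apply: contra_neq d1 => h.
have -> : 1 - s / r ^+ 2 * w = (r ^+ 2 - s * w) / r ^+ 2 by field.
by rewrite h mul0r.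
Qed.

Lemma Psi_ball_derive s : 0 < s < r ^+ 2 -> is_derive s 1 Psi_ball (dPsi_ball s).
Proof.
move=> /andP[s0 sr]; have d0 := ball_factor_den_gt0 (introT andP (conj (ltW s0) sr)).
have q0 : 0 < Num.sqrt s by rewrite sqrtr_gt0.
have d1 := is_derive1_sqrt s0.
have d2 : is_derive s 1 (fun s : R => Num.sqrt s / r) ((2 * Num.sqrt s)^-1 / r).
  rewrite [X in is_derive _ _ _ X]mulrC.
  rewrite (_ : (fun _ => _) = r^-1 \*: @Num.sqrt R); last first.
    by apply/funext => y; rewrite /= mulrC.
  exact: is_deriveZ.
have d3 : is_derive (Num.sqrt s / r) 1 (fun w : R => w ^+ N) (N%:R * (Num.sqrt s / r) ^+ N.-1).
  apply: DeriveDef; first exact: exprn_derivable.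
  by rewrite exp_derive [_ *: 1]mulr1.
have d4 := @is_derive1_comp _ (fun w : R => w ^+ N) (fun s : R => Num.sqrt s / r) _ _ _ d3 d2.
have d5 : is_derive s 1 (fun s : R => 1 - (Num.sqrt s / r) ^+ N)
    (0 - (N%:R * (Num.sqrt s / r) ^+ N.-1 * ((2 * Num.sqrt s)^-1 / r))).
  exact: (is_deriveB (is_derive_cst _ _ _) d4).
have d6 := @is_deriveV _ (fun s : R => 1 - (Num.sqrt s / r) ^+ N) _ _ _ (lt0r_neq0 d0) d5.
have d7 := @is_deriveZ _ _ _ _ (- (N%:R / 2)) _ _ _ d6.
have -> : dPsi_ball s = - (N%:R / 2) *: (- (1 - (Num.sqrt s / r) ^+ N) ^- 2 *:
  (0 - (N%:R * (Num.sqrt s / r) ^+ N.-1 * ((2 * Num.sqrt s)^-1 / r))) : R^o).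
  rewrite /dPsi_ball /ball_factor /GRing.scale/=.
  have -> : (Num.sqrt s / r) ^+ N.-1 = Num.sqrt s / r * (Num.sqrt s / r) ^+ (N - 2).
    by rewrite -exprS; congr (_ ^+ _); case: N hN => [|[|m]]//= _; rewrite subn2.
  move: d0 => /lt0r_neq0; have := lt0r_neq0 q0; have := lt0r_neq0 r0.
  move: (Num.sqrt s) (N%:R : R) (1 - _) (_ ^+ (N - 2)) => q n D w rn qn Dn.
  by field; rewrite rn qn Dn.
exact: d7.
Qed.

Lemma riccati_below_ball : riccati_below (r ^+ 2) Psi_ball dPsi_ball.
Proof.
have cz s : {for s, continuous (fun s : R => Num.sqrt s / r)}.
  by apply: cvgM; [exact: sqrt_continuous|exact: cvg_cst].
have cX n s : {for s, continuous (fun s : R => (Num.sqrt s / r) ^+ n)}.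
  exact: (continuous_comp (cz s) (@exprn_continuous R n _)).
have cy s : 0 <= s < r ^+ 2 -> {for s, continuous ball_factor}.
  move=> sr; apply: cvgV; first by rewrite gt_eqF// ball_factor_den_gt0.
  by apply: cvgB; [exact: cvg_cst|exact: cX].
apply: riccati_below_continuous.
- exact: Psi_ball_derive.
- by move=> s sr; apply: cvgM; [exact: cvg_cst|exact: cy].
- move=> s sr; apply: cvgM.
    by apply: cvgM; [exact: cvg_cst|exact: cX].
  exact: (continuous_comp (cy s sr) (@exprn_continuous R 2 _)).
- by move=> s sr; rewrite riccati_ball// mulr_ge0// ?sqr_ge0// divr_ge0// sqr_ge0.
Qed.

End ball.

Section bessel.
Variables (r z0 : R).
Hypotheses (r0 : 0 < r) (z0P : first_positive_zero bessel_J0 z0).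

Definition bessel_scale : R := z0 ^+ 2 / r ^+ 2.

(** The radial function behind this case is
    [phi = |x| ^ (- N / 2) J_0 (z0 |x| / r)], which vanishes on the sphere of radius
    [r]; twice [theta_bessel] is the logarithmic derivative of the second factor. *)
Definition theta_bessel s : R := bessel_scale * s * bessel_j' (bessel_scale * s) / bessel_j (bessel_scale * s).
Definition Psi_bessel s := - (N%:R / 2) + 2 * theta_bessel s.
Definition dPsi_bessel s :=
  - (bessel_scale / 2) - 2 * bessel_scale * (bessel_scale * s * bessel_j' (bessel_scale * s) ^+ 2) / bessel_j (bessel_scale * s) ^+ 2.

Lemma z0_gt0 : 0 < z0.
Proof. by case: z0P. Qed.

Lemma bessel_scale_gt0 : 0 < bessel_scale.
Proof. by rewrite divr_gt0// exprn_gt0// z0_gt0. Qed.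

Lemma bessel_j_scale_gt0 s : 0 <= s < r ^+ 2 -> 0 < bessel_j (bessel_scale * s).
Proof.
move=> /andP[s0 sr]; apply: bessel_j_gt0 z0P _; rewrite mulr_ge0// ?ltW ?bessel_scale_gt0//=.
by rewrite /bessel_scale mulrAC ltr_pdivrMr ?exprn_gt0// ltr_pM2l// exprn_gt0// z0_gt0.
Qed.

Lemma riccati_bessel s : 0 <= s < r ^+ 2 ->
  riccati Psi_bessel dPsi_bessel s = N%:R ^+ 2 / 4 + bessel_scale * s.
Proof.
move=> sr; have := lt0r_neq0 (bessel_j_scale_gt0 sr).
rewrite /riccati /Psi_bessel /dPsi_bessel /theta_bessel.
move: (bessel_j (bessel_scale * s)) (bessel_j' (bessel_scale * s)) (N%:R : R) => j j' n jn; move: bessel_scale => k.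
by field.
Qed.

Lemma Psi_bessel_derive s : 0 <= s < r ^+ 2 -> is_derive s 1 Psi_bessel (dPsi_bessel s).
Proof.
move=> sr; have jn := lt0r_neq0 (bessel_j_scale_gt0 sr).
have d1 : is_derive s 1 (fun s : R => bessel_scale * s) (bessel_scale *: 1).
  exact: (@is_deriveZ _ _ _ id bessel_scale).
have d2 := @is_derive1_comp _ (fun t => t * bessel_j' t) (fun s => bessel_scale * s) _ _ _
  (bessel_equation (bessel_scale * s)) d1.
have d3 := @is_derive1_comp _ bessel_j (fun s => bessel_scale * s) _ _ _ (bessel_j_derive (bessel_scale * s)) d1.
have d4 := @is_deriveV _ (fun s => bessel_j (bessel_scale * s)) _ _ _ jn d3.
have d5 := is_deriveM d2 d4.
have d6 := @is_deriveZ _ _ _ _ 2 _ _ _ d5.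
have d7 := is_deriveD (is_derive_cst (- (N%:R / 2) : R) s 1) d6.
apply: (@is_derive_eq _ _ _ _ _ _ _ _ d7).
rewrite /dPsi_bessel /GRing.scale/=.
move: (bessel_j (bessel_scale * s)) (bessel_j' (bessel_scale * s)) jn => j j' jn; move: bessel_scale => k.
by field.
Qed.

Lemma riccati_below_bessel : riccati_below (r ^+ 2) Psi_bessel dPsi_bessel.
Proof.
apply: riccati_below_continuous.
- by move=> s /andP[s0 sr]; apply: Psi_bessel_derive; rewrite (ltW s0) sr.
- by move=> s sr; apply: continuous_derive (Psi_bessel_derive sr).
- move=> s sr.
  have ck : {for s, continuous (fun s : R => bessel_scale * s)}.
    by apply: cvgM; [exact: cvg_cst|exact: cvg_id].
  have cj : {for s, continuous (fun s : R => bessel_j (bessel_scale * s))}.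
    exact: (continuous_comp ck (continuous_derive (bessel_j_derive _))).
  have cj' : {for s, continuous (fun s : R => bessel_j' (bessel_scale * s))}.
    exact: (continuous_comp ck (@bessel_j'_continuous R _)).
  apply: cvgB; first exact: cvg_cst.
  apply: cvgM.
    apply: cvgM; first exact: cvg_cst.
    by apply: cvgM => //; exact: (continuous_comp cj' (@exprn_continuous R 2 _)).
  apply: cvgV; first by rewrite expf_neq0// lt0r_neq0// bessel_j_scale_gt0.
  exact: (continuous_comp cj (@exprn_continuous R 2 _)).
- move=> s /andP[s0 sr]; rewrite riccati_bessel; last by rewrite (ltW s0) sr.
  apply: addr_ge0; first by rewrite divr_ge0// sqr_ge0.
  by apply: mulr_ge0; [exact: (ltW bessel_scale_gt0)|exact: ltW].
Qed.

End bessel.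
End riccati_solutions.

(** * The three inequalities *)

Section bridge.
Context {R : realType} {N : nat}.
Local Notation V := 'rV[R]_N.
Implicit Types (u : V -> R) (x : V).
Local Notation mu := (lebesgue_rV N).

Lemma enorm_sqr x : enorm x ^+ 2 = sqn x.
Proof. by rewrite sqr_sqrtr// sqn_ge0. Qed.

Lemma enorm_gradient_sqr u x : enorm (gradient u x) ^+ 2 = gradsq u x.
Proof. by rewrite enorm_sqr /gradsq pdE; apply: eq_bigr => k _; rewrite mxE. Qed.

Lemma laplacianE u x : laplacian u x = lapl u x.
Proof. by rewrite /lapl pdE. Qed.

Lemma eball_sqn (r : R) x : 0 < r -> eball r x <-> sqn x < r ^+ 2.
Proof.
move=> r0; rewrite -enorm_sqr /eball/= ltr_pXn2r// ?nnegrE ?sqrtr_ge0// ltW//.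
Qed.

(** The maximum of [|x| ^ 2] on the compact support serves as [t1], and it is
    reached inside [Omega]. *)
Lemma test_function_below Omega u : test_function Omega u ->
  exists2 t1, test_below t1 u & t1 = 0 \/ exists2 c, Omega c & t1 = sqn c.
Proof.
move=> [su cu uO].
have out x : ~ supp u x -> u x = 0.
  move=> nx; apply: contra_notP nx => /eqP ux.
  exact: (@subset_closure _ [set x | u x != 0]).
have [s0|s0] := pselect (supp u !=set0).
  have cs : {within supp u, continuous (@sqn R N)}.
    by apply: continuous_subspaceT; exact: smooth_continuous smooth_sqn.
  have [c cS cmax] := compact_EVT_max s0 cu cs.
  exists (sqn c); last by right; exists c => //; apply: uO; rewrite inE in cS.
  split=> // x cx; apply: out => sx.
  by have := cmax x (mem_set sx); rewrite leNgt cx.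
exists 0; last by left.
by split=> // x _; apply: out => sx; apply: s0; exists x.
Qed.

Lemma test_function_ball (r : R) u : 0 < r -> test_function (eball r) u ->
  exists2 t1, t1 < r ^+ 2 & test_below t1 u.
Proof.
move=> r0 /test_function_below[t1 tu h]; exists t1 => //.
case: h => [->|[c cr ->]]; first by rewrite exprn_gt0.
exact/(eball_sqn _ r0).
Qed.

Lemma integral_eball (r t1 : R) (f : V -> R) : 0 < r -> t1 < r ^+ 2 ->
  (forall x, t1 < sqn x -> f x = 0) ->
  (\int[mu]_(x in eball r) (f x)%:E = \int[mu]_x (f x)%:E)%E.
Proof.
move=> r0 tr f0; rewrite [LHS]integral_mkcond; apply: eq_integral => x _.
rewrite patchE; case: ifPn => //; rewrite notin_setE => xr.
rewrite f0// (lt_le_trans tr)// leNgt; apply/negP => sr.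
by apply: xr; exact/(eball_sqn _ r0).
Qed.

Lemma integral_gradient_weight (g d : V -> R) (c : R) : 0 < c ->
  (forall x, 0 <= g x) -> measurable_fun setT d -> (forall x, d x = c * g x) ->
  measurable_fun setT g /\
  (\int[mu]_x (d x)%:E = c%:E * \int[mu]_x (g x)%:E)%E.
Proof.
move=> c0 g0 md dE.
have mg : measurable_fun setT g.
  rewrite (_ : g = fun x => c^-1 * d x); first exact: measurable_funM.
  by apply/funext => x; rewrite dE mulrA mulVf ?mul1r// gt_eqF.
split=> //; rewrite -ge0_integralZl_EFin//.
- by apply: eq_integral => x _; rewrite dE.
- by move=> x _; rewrite lee_fin.
- exact/measurable_EFinP.
- exact: ltW.
Qed.

Lemma lebesgue_rV_point : (0 < N)%N -> mu [set 0 : V] = 0%E.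
Proof.
move=> N0; rewrite (_ : [set 0] = [set x : V | forall i, [set (0 : R)] (x ord0 i)]).
  rewrite (lebesgue_rV_box (fun=> measurable_set1 0)).
  case: N N0 => // n _; rewrite big_ord_recl.
  by rewrite lebesgue_measure_set1 mul0e.
apply/seteqP; split => x /=; first by move=> -> i; rewrite mxE.
by move=> h; apply/rowP => i; rewrite mxE h.
Qed.

Lemma integral_lin2 (g1 g2 : V -> R) (c1 c2 : R) : 0 <= c1 -> 0 <= c2 ->
  (forall x, 0 <= g1 x) -> (forall x, 0 <= g2 x) ->
  measurable_fun setT g1 -> measurable_fun setT g2 ->
  (\int[mu]_x (c1 * g1 x + c2 * g2 x)%:E =
   c1%:E * \int[mu]_x (g1 x)%:E + c2%:E * \int[mu]_x (g2 x)%:E)%E.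
Proof.
move=> c10 c20 g10 g20 m1 m2.
have Z (c : R) (g : V -> R) : 0 <= c -> (forall x, 0 <= g x) -> measurable_fun setT g ->
    (c%:E * \int[mu]_x (g x)%:E = \int[mu]_x (c * g x)%:E)%E.
  move=> c0 g0 mg; rewrite -ge0_integralZl_EFin//.
  - by move=> x _; rewrite lee_fin.
  - exact/measurable_EFinP.
rewrite !Z// -ge0_integralD//.
- by move=> x _; rewrite lee_fin mulr_ge0.
- by apply/measurable_EFinP; exact: measurable_funM.
- by move=> x _; rewrite lee_fin mulr_ge0.
- by apply/measurable_EFinP; exact: measurable_funM.
Qed.

(** Needed because the convention [x / 0 = 0] makes the two sides differ at
    the origin. *)
Lemma integral_off_origin (f g : V -> R) : (0 < N)%N ->
  measurable_fun setT f -> measurable_fun setT g ->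
  (forall x, 0 <= f x) -> (forall x, 0 <= g x) ->
  (forall x, x != 0 -> f x = g x) ->
  (\int[mu]_x (f x)%:E = \int[mu]_x (g x)%:E)%E.
Proof.
move=> N0 mf mg f0 g0 fg; apply: ge0_ae_eq_integral => //.
- exact/measurable_EFinP.
- exact/measurable_EFinP.
- by move=> x _; rewrite lee_fin.
- by move=> x _; rewrite lee_fin.
exists [set 0 : V]; split.
- rewrite (_ : [set 0] = [set x : V | forall i, [set (0 : R)] (x ord0 i)]).
    by apply: (@measurable_rV_box R N (fun=> [set 0])).
  apply/seteqP; split => x /=; first by move=> -> i; rewrite mxE.
  by move=> h; apply/rowP => i; rewrite mxE h.
- exact: lebesgue_rV_point.
- move=> x /= h; apply/eqP; apply: contra_notT h => x0 _.
  by rewrite fg.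
Qed.

End bridge.

Theorem corollary1p2 (R : realType) (N : nat) (r : R) (hN : (5 <= N)%N)
    (hr : 0 < r) :
  [/\ forall u : 'rV[R]_N -> R, test_function setT u ->
        (\int[lebesgue_rV N]_x ((laplacian u x) ^+ 2)%:E >=
         (N%:R ^+ 2 / 4)%:E *
         \int[lebesgue_rV N]_x (enorm (gradient u x) ^+ 2 / enorm x ^+ 2)%:E)%E,
      forall u : 'rV[R]_N -> R, test_function (eball r) u ->
        (\int[lebesgue_rV N]_(x in eball r) ((laplacian u x) ^+ 2)%:E >=
         (N%:R ^+ 2 / 4)%:E *
         \int[lebesgue_rV N]_(x in eball r)
           (enorm (gradient u x) ^+ 2 /
            (enorm x ^+ 2 * (1 - (r / enorm x) ^- N) ^+ 2))%:E)%E
    & forall z0 : R, first_positive_zero bessel_J0 z0 ->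
      forall u : 'rV[R]_N -> R, test_function (eball r) u ->
        (\int[lebesgue_rV N]_(x in eball r) ((laplacian u x) ^+ 2)%:E >=
         (N%:R ^+ 2 / 4)%:E *
         \int[lebesgue_rV N]_(x in eball r)
           (enorm (gradient u x) ^+ 2 / enorm x ^+ 2)%:E +
         (z0 ^+ 2 / r ^+ 2)%:E *
         \int[lebesgue_rV N]_(x in eball r) (enorm (gradient u x) ^+ 2)%:E)%E].

Proof.
have N0 : 0 < N%:R :> R by rewrite ltr0n (leq_trans _ hN).
have c0 : 0 < N%:R ^+ 2 / 4 :> R by rewrite divr_gt0// exprn_gt0.
have N2 : (2 <= N)%N by exact: leq_trans hN.
have lapE (u : 'rV[R]_N -> R) :
    (\int[lebesgue_rV N]_x (laplacian u x ^+ 2)%:E =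
     \int[lebesgue_rV N]_x (lapl u x ^+ 2)%:E)%E.
  by apply: eq_integral => x _; rewrite laplacianE.
have hardy (u : 'rV[R]_N -> R) (t1 : R) : test_below t1 u ->
    [/\ measurable_fun setT (fun x => enorm (gradient u x) ^+ 2 / enorm x ^+ 2),
     (forall x, 0 <= enorm (gradient u x) ^+ 2 / enorm x ^+ 2) &
     ((N%:R ^+ 2 / 4)%:E * \int[lebesgue_rV N]_x (enorm (gradient u x) ^+ 2 / enorm x ^+ 2)%:E
      <= \int[lebesgue_rV N]_x (lapl u x ^+ 2)%:E)%E].
  move=> tu.
  have tT : t1 < t1 + 1 by rewrite ltrDl.
  have [md le] := rellich_riccati hN tT tu (riccati_below_cst _).
  have g0 x : 0 <= enorm (gradient u x) ^+ 2 / enorm x ^+ 2 by rewrite divr_ge0// sqr_ge0.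
  have [|mg E] := integral_gradient_weight c0 g0 md.
    move=> x; rewrite /rellich_density riccati_cst enorm_gradient_sqr enorm_sqr.
    by rewrite mulrAC mulrA.
  by split => //; rewrite -E.
split.
- move=> u /test_function_below[t1 tu _]; rewrite lapE.
  by have [] := hardy u t1 tu.
- move=> u /(test_function_ball hr)[t1 tr tu].
  have [_ tl] := test_sqr (test_lapl tu); have [_ tg] := test_gradsq tu.
  rewrite (integral_eball hr tr); last first.
    by move=> x tx; rewrite enorm_gradient_sqr tg// mul0r.
  rewrite (integral_eball hr tr); last by move=> x tx; rewrite laplacianE; exact: tl.
  rewrite lapE.
  have [md le] := rellich_riccati hN tr tu (riccati_below_ball hr N2).
  apply: le_trans le.
  pose g x := enorm (gradient u x) ^+ 2 /
    (enorm x ^+ 2 * (1 - (r / enorm x) ^- N) ^+ 2).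
  have g0 x : 0 <= g x.
    by apply: divr_ge0; [exact: sqr_ge0|apply: mulr_ge0; exact: sqr_ge0].
  suff dE (x : 'rV[R]_N) : rellich_density (@Psi_ball R N r) (@dPsi_ball R N r) u x = N%:R ^+ 2 / 4 * g x.
    by have [_ ->] := integral_gradient_weight c0 g0 md dE.
  rewrite /rellich_density /g enorm_gradient_sqr.
  have [xt|tx] := leP (sqn x) t1; last by rewrite tg// !mulr0 mul0r mulr0.
  have [x0|x0] := eqVneq (sqn x) 0.
    by rewrite enorm_sqr x0 invr0 !mul0r invr0 !mulr0 mul0r.
  have xr : 0 < sqn x < r ^+ 2 by rewrite lt_neqAle eq_sym x0 sqn_ge0 (le_lt_trans xt).
  rewrite riccati_ball// /ball_factor -exprVn invf_div -[Num.sqrt _]/(enorm x) enorm_sqr.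
  rewrite invfM -[(_ ^+ 2)^-1]exprVn; ring.
- move=> z0 z0P u /(test_function_ball hr)[t1 tr tu].
  have [_ tl] := test_sqr (test_lapl tu); have [sg tg] := test_gradsq tu.
  rewrite (integral_eball hr tr); last first.
    by move=> x tx; rewrite enorm_gradient_sqr tg// mul0r.
  rewrite (integral_eball hr tr); last by move=> x tx; rewrite enorm_gradient_sqr tg.
  rewrite (integral_eball hr tr); last by move=> x tx; rewrite laplacianE; exact: tl.
  rewrite lapE.
  have [md le] := rellich_riccati hN tr tu (riccati_below_bessel hr z0P).
  apply: le_trans le.
  have [mh h0 _] := hardy u t1 tu.
  have k0 := bessel_scale_gt0 hr z0P.
  have mg : measurable_fun setT (fun x => enorm (gradient u x) ^+ 2).
    rewrite (_ : (fun x => _) = gradsq u); last by apply/funext => x; exact: enorm_gradient_sqr.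
    by apply: continuous_measurable_rV; exact: smooth_continuous.
  have g0 x : 0 <= enorm (gradient u x) ^+ 2 by exact: sqr_ge0.
  rewrite -/(bessel_scale r z0) -integral_lin2//; [|exact: ltW..].
  rewrite (@integral_off_origin R N _ (rellich_density (@Psi_bessel R N r z0) (@dPsi_bessel R r z0) u))//.
  + exact: leq_trans hN.
  + by apply: measurable_funD; exact: measurable_funM.
  + by move=> x; apply: addr_ge0; apply: mulr_ge0 => //; exact: ltW.
  + move=> x; have [xt|tx] := leP (sqn x) t1; last first.
      by rewrite /rellich_density tg// mulr0.
    rewrite /rellich_density riccati_bessel ?sqn_ge0 ?(le_lt_trans xt)//.
    apply: mulr_ge0; last exact: gradsq_ge0.
    apply: divr_ge0; last exact: sqn_ge0.
    by apply: addr_ge0; [exact: ltW|apply: mulr_ge0; [exact: ltW|exact: sqn_ge0]].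
  + move=> x x0; rewrite /rellich_density enorm_gradient_sqr enorm_sqr.
    have [xt|tx] := leP (sqn x) t1; last by rewrite tg// !mul0r !mulr0 addr0.
    rewrite riccati_bessel ?sqn_ge0 ?(le_lt_trans xt)//.
    suff : sqn x != 0 by move=> ?; field.
    apply: contra_neq x0 => s0; apply/rowP => i; rewrite mxE; apply/eqP.
    have /psumr_eq0P := s0 => /(_ (fun k _ => sqr_ge0 (x ord0 k))) /(_ i isT)/eqP.
    by rewrite sqrf_eq0.
Qed.
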